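(* Let $F$ be a local nonarchimedean field of odd residual characteristic, and suppose its residue field has $q$ elements. Let $K$ be a quadratic extension of $F$. Then the distinct isomorphism classes of nonassociative quaternion algebras with left nucleus $K$ are given (each exactly once) by $(K/F,\sigma,a)$ where $\sigma\in\mathrm{Gal}(K/F)$ is the nontrivial element and $a\in\mathcal{S}(K)$, where $\mathcal{S}(K)$ is given as follows: (1) If $K=F(\sqrt{\varepsilon})$ is unramified, then $$\mathcal{S}(K)=\{\sqrt{\varepsilon},\ \varpi\sqrt{\varepsilon},\ 1+s\sqrt{\varepsilon},\ \varpi+s\sqrt{\varepsilon}\mid s\in F^\times/\{\pm1\}\}.$$ (2) If $K=F(\sqrt{\alpha})$ is ramified, where $\alpha\in\{\varpi,\varepsilon\varpi\}$, then (a) if $q\equiv1\bmod 4$, $$\mathcal{S}(K)=\{\sqrt{\alpha},\ \varepsilon\sqrt{\alpha},\ 1+s\sqrt{\alpha},\ \varepsilon+s\sqrt{\alpha}\mid s\in F^\times/\{\pm1\}\};$$ (b) if $q\equiv3\bmod 4$, $$\mathcal{S}(K)=\{\sqrt{\alpha},\ \pm1+s\sqrt{\alpha}\mid s\in F^\times/\{\pm1\}\}.$$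
   Context: A local nonarchimedean field is a finite extension of $\mathbb{Q}_p$ or a field $\mathbb{F}_q(\!(t)\!)$ of Laurent series over a finite field. $\mathcal{R}$ denotes its ring of integers, $\mathcal{P}$ the maximal ideal of $\mathcal{R}$, $\varpi$ a fixed generator of $\mathcal{P}$, and $\mathcal{R}/\mathcal{P}$ the residue field, of order $q$; its characteristic is the residual characteristic. $\varepsilon\in\mathcal{R}^\times\smallsetminus(\mathcal{R}^\times)^2$ is a fixed nonsquare unit. The three quadratic extensions of $F$ (up to isomorphism) are $F(\sqrt{\varepsilon})$ (unramified) and $F(\sqrt{\varpi})$, $F(\sqrt{\varepsilon\varpi})$ (ramified). For a quadratic Galois extension $K/F$ with nontrivial automorphism $\sigma$ and $a\in K\smallsetminus F$, the (proper) nonassociative quaternion algebra $(K/F,\sigma,a)$ is the unital $4$-dimensional $F$-algebra $K\oplus Kt$ with $F$-bilinear multiplication determined by $(k)(k')=kk'$, $(k)(k't)=kk't$, $(kt)(k')=k\sigma(k')t$, $(kt)(k't)=k\sigma(k')a$ for $k,k'\in K$. The left nucleus of an algebra $A$ is $\{x\in A:(xy)z=x(yz)\ \forall y,z\in A\}$; for $(K/F,\sigma,a)$ with $a\in K\smallsetminus F$ it equals $K$. Isomorphism means isomorphism of $F$-algebras. $F^\times/\{\pm1\}$ stands for a set of representatives in $F^\times$ of the cosets of $\{\pm1\}$. *)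

(* Defs.v *)
From HB Require Import structures.
From mathcomp Require Import all_boot all_order all_algebra.
From mathcomp Require Import falgebra fieldext.
From mathcomp Require Import boolp classical_sets.

Set Implicit Arguments.
Unset Strict Implicit.
Unset Printing Implicit Defensive.

Import GRing.Theory.
Local Open Scope ring_scope.

(* The p-adic numbers: Z_p is the inverse limit of the rings Z/p^(n+1) (the  *)
(* exponents start at 1 because 'Z_1 is not the zero ring in MathComp), and  *)
(* Q_p is its fraction field.                                                *)

Definition prime_nat := {p : nat | prime p}.

Section PadicIntegers.
Variable p : prime_nat.
Local Notation q n := (sval p ^ n.+1)%N.

Definition coherent (x : forall n, 'Z_(q n)) : Prop :=
  forall n, (x n.+1 : nat) = x n %[mod q n].

Record padic_int := PadicInt {
  padic_res :> forall n, 'Z_(q n);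
  padic_coherent : coherent padic_res
}.

Lemma padic_mod_gt1 n : (1 < q n)%N.
Proof.
by rewrite -{1}(exp1n n.+1) ltn_exp2r // prime_gt1 //; exact: svalP p.
Qed.

Lemma padic_int_eq (x y : padic_int) : (forall n, x n = y n) -> x = y.
Proof.
case: x y => [x hx] [y hy] /= exy.
have {}exy : x = y by exact: functional_extensionality_dep.
by case: y / exy hy => hy; congr PadicInt; exact: Prop_irrelevance.
Qed.

HB.instance Definition _ := gen_eqMixin padic_int.
HB.instance Definition _ := gen_choiceMixin padic_int.

Lemma padic_val_mod n (m : nat) :
  (m %% (Zp_trunc (q n)).+2 = m %% q n)%N.
Proof. by rewrite (Zp_cast (padic_mod_gt1 n)). Qed.

Lemma padic_modS n m : (m %% q n.+1 = m %[mod q n])%N.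
Proof. by rewrite modn_dvdm // dvdn_exp2l. Qed.

Fact padic0_subproof : coherent (fun=> 0).
Proof. by []. Qed.
Definition padic0 := PadicInt padic0_subproof.

Fact padic1_subproof : coherent (fun=> 1).
Proof. by move=> n; rewrite /= !padic_val_mod padic_modS modn_mod. Qed.
Definition padic1 := PadicInt padic1_subproof.

Fact padic_add_subproof (x y : padic_int) : coherent (fun n => x n + y n).
Proof.
move=> n; rewrite /= !padic_val_mod padic_modS modn_mod.
by rewrite -modnDm !padic_coherent modnDm.
Qed.
Definition padic_add x y := PadicInt (padic_add_subproof x y).

Fact padic_mul_subproof (x y : padic_int) : coherent (fun n => x n * y n).
Proof.
move=> n; rewrite /= !padic_val_mod padic_modS modn_mod.
by rewrite -modnMm !padic_coherent modnMm.
Qed.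
Definition padic_mul x y := PadicInt (padic_mul_subproof x y).

Fact padic_opp_subproof (x : padic_int) : coherent (fun n => - x n).
Proof.
have e m : ((- x m)%R + x m = 0 %[mod q m])%N.
  have : (- x m + x m)%R = 0%N :> nat by rewrite addNr.
  by rewrite /= [X in X = _]padic_val_mod => ->; rewrite mod0n.
move=> n; apply/eqP; rewrite -(eqn_modDr (x n)) e; apply/eqP.
rewrite -modnDmr -padic_coherent modnDmr.
by rewrite -padic_modS e padic_modS.
Qed.
Definition padic_opp x := PadicInt (padic_opp_subproof x).

Fact padic_addA : associative padic_add.
Proof. by move=> x y z; apply: padic_int_eq => n; apply: addrA. Qed.
Fact padic_addC : commutative padic_add.
Proof. by move=> x y; apply: padic_int_eq => n; apply: addrC. Qed.
Fact padic_add0 : left_id padic0 padic_add.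
Proof. by move=> x; apply: padic_int_eq => n; apply: add0r. Qed.
Fact padic_addN : left_inverse padic0 padic_opp padic_add.
Proof. by move=> x; apply: padic_int_eq => n; apply: addNr. Qed.

HB.instance Definition _ := GRing.isZmodule.Build padic_int
  padic_addA padic_addC padic_add0 padic_addN.

Fact padic_mulA : associative padic_mul.
Proof. by move=> x y z; apply: padic_int_eq => n; apply: mulrA. Qed.
Fact padic_mulC : commutative padic_mul.
Proof. by move=> x y; apply: padic_int_eq => n; apply: mulrC. Qed.
Fact padic_mul1 : left_id padic1 padic_mul.
Proof. by move=> x; apply: padic_int_eq => n; apply: mul1r. Qed.
Fact padic_mulDl : left_distributive padic_mul padic_add.
Proof. by move=> x y z; apply: padic_int_eq => n; apply: mulrDl. Qed.
Fact padic_1neq0 : padic1 != padic0.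
Proof.
apply/eqP => /(congr1 (fun x : padic_int => x 0%N)).
by move/eqP; rewrite /= oner_eq0.
Qed.

HB.instance Definition _ := GRing.Zmodule_isComNzRing.Build padic_int
  padic_mulA padic_mulC padic_mul1 padic_mulDl padic_1neq0.

Lemma padic_coherent_le (x : padic_int) n m : (n <= m)%N ->
  (x m : nat) = x n %[mod q n].
Proof.
elim: m => [|m IH]; first by rewrite leqn0 => /eqP->.
rewrite leq_eqVlt => /predU1P[-> //|]; rewrite ltnS => lnm.
rewrite -IH // -(modn_dvdm (x m.+1) (dvdn_exp2l _ (_ : n.+1 <= m.+1)%N)) //.
by rewrite padic_coherent modn_dvdm // dvdn_exp2l.
Qed.

Lemma padic_eq0 n (a : 'Z_(q n)) : (a == 0) = (q n %| a)%N.
Proof.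
rewrite /dvdn -padic_val_mod modn_small; last exact: ltn_ord.
by [].
Qed.

Fact padic_idomain (x y : padic_int) : x * y = 0 -> (x == 0) || (y == 0).
Proof.
move=> xy0; apply: contrapT => /negP; rewrite negb_or => /andP[x0 y0].
have nz (z : padic_int) : z != 0 -> exists n, ~~ (q n %| z n)%N.
  move=> z0; apply: contrapT => /forallNP hz; case/eqP: z0.
  apply: padic_int_eq => n; apply/eqP; rewrite padic_eq0.
  by apply/negPn/negP; exact: hz.
have [n hn] := nz _ x0; have [m hm] := nz _ y0.
have pp : prime (sval p) := svalP p.
have dv (z : padic_int) k l : (k <= l)%N -> (q k %| z l)%N = (q k %| z k)%N.
  by move=> kl; rewrite /dvdn padic_coherent_le.
pose N := (n.+1 + m.+1)%N.
have hx : ~~ (q n %| x N)%N by rewrite dv // /N addSn ltnW // ltnS leq_addr.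
have hy : ~~ (q m %| y N)%N by rewrite dv // /N addnS ltnW // ltnS leq_addl.
have xN0 : (0 < x N)%N by case: posnP hx => // ->; rewrite dvdn0.
have yN0 : (0 < y N)%N by case: posnP hy => // ->; rewrite dvdn0.
have := congr1 (fun z : padic_int => z N) xy0 => /eqP.
rewrite -[X in X == _]/(x N * y N : 'Z_(q N)) padic_eq0 /= padic_val_mod.
rewrite /dvdn modn_mod -/(_ %| _)%N => h.
move: hx hy; rewrite !pfactor_dvdn // -!ltnNge !ltnS => lx ly.
move: h; rewrite pfactor_dvdn ?muln_gt0 ?xN0 // lognM //.
move=> h; have := leq_trans h (leq_add lx ly).
by rewrite /N addSn addnS ltnNge !leqW.
Qed.

Definition padic_unit : pred padic_int := fun x => `[< exists y, y * x = 1 >].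
Definition padic_inv (x : padic_int) : padic_int :=
  if pselect (exists y, y * x = 1) is left e then projT1 (cid e) else x.

Fact padic_mulVr : {in padic_unit, left_inverse 1 padic_inv *%R}.
Proof.
move=> x /asboolP hx; rewrite /padic_inv; case: pselect => // e.
exact: (projT2 (cid e)).
Qed.
Fact padic_unitP (x y : padic_int) : y * x = 1 -> padic_unit x.
Proof. by move=> yx; apply/asboolP; exists y. Qed.
Fact padic_inv_out : {in [predC padic_unit], padic_inv =1 id}.
Proof.
by move=> x /asboolP hx; rewrite /padic_inv; case: pselect.
Qed.

HB.instance Definition _ := GRing.ComNzRing_hasMulInverse.Build padic_int
  padic_mulVr padic_unitP padic_inv_out.
HB.instance Definition _ := GRing.ComUnitRing_isIntegral.Build padic_int
  padic_idomain.

Definition padic := {fraction padic_int}.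
HB.instance Definition _ := GRing.Field.on padic.

End PadicIntegers.

(* Formal power series k[[t]] with the Cauchy product.  Every nonzero power  *)
(* series is t^n times a unit, so the fraction field of k[[t]] is the field  *)
(* k((t)) of Laurent series.                                                 *)

Section PowerSeries.
Variable k : fieldType.

Record pseries := PSeries { pcoef : nat -> k }.

Lemma pseries_eq (f g : pseries) : pcoef f =1 pcoef g -> f = g.
Proof. by case: f g => [f] [g] /= /funext ->. Qed.

HB.instance Definition _ := gen_eqMixin pseries.
HB.instance Definition _ := gen_choiceMixin pseries.

Definition pseries0 := PSeries (fun=> 0).
Definition pseries1 := PSeries (fun n => (n == 0%N)%:R).
Definition pseries_opp f := PSeries (fun n => - pcoef f n).
Definition pseries_add f g := PSeries (fun n => pcoef f n + pcoef g n).
Definition pseries_mul f g :=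
  PSeries (fun n => \sum_(i < n.+1) pcoef f i * pcoef g (n - i)%N).

Fact pseries_addA : associative pseries_add.
Proof. by move=> x y z; apply: pseries_eq => n; apply: addrA. Qed.
Fact pseries_addC : commutative pseries_add.
Proof. by move=> x y; apply: pseries_eq => n; apply: addrC. Qed.
Fact pseries_add0 : left_id pseries0 pseries_add.
Proof. by move=> x; apply: pseries_eq => n; apply: add0r. Qed.
Fact pseries_addN : left_inverse pseries0 pseries_opp pseries_add.
Proof. by move=> x; apply: pseries_eq => n; apply: addNr. Qed.

HB.instance Definition _ := GRing.isZmodule.Build pseries
  pseries_addA pseries_addC pseries_add0 pseries_addN.

Definition ptrunc n (f : pseries) : {poly k} := \poly_(i < n.+1) pcoef f i.

Lemma coef_ptrunc n f i : (i <= n)%N -> (ptrunc n f)`_i = pcoef f i.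
Proof. by move=> le_in; rewrite coef_poly ltnS le_in. Qed.

Lemma coef_ptruncM n f g i : (i <= n)%N ->
  (ptrunc n f * ptrunc n g)`_i = pcoef (pseries_mul f g) i.
Proof.
move=> le_in; rewrite coefM; apply: eq_bigr => j _.
by rewrite !coef_ptrunc // ?(leq_trans (leq_subr _ _)) // (leq_trans _ le_in) // -ltnS.
Qed.

Fact pseries_mulC : commutative pseries_mul.
Proof.
move=> f g; apply: pseries_eq => n.
by rewrite -!(coef_ptruncM _ _ (leqnn n)) mulrC.
Qed.

Fact pseries_mulA : associative pseries_mul.
Proof.
move=> f g h; apply: pseries_eq => n.
transitivity (ptrunc n f * ptrunc n g * ptrunc n h)`_n.
  rewrite -mulrA -(coef_ptruncM _ _ (leqnn n)) coefM [RHS]coefM;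
  apply: eq_bigr => i _.
  by rewrite [in RHS](coef_ptruncM _ _ (leq_subr i n)) (coef_ptrunc _ (leq_subr i n)).
rewrite -(coef_ptruncM _ _ (leqnn n)) coefM [RHS]coefM;
  apply: eq_bigr => i _.
have le_in : (i <= n)%N by rewrite -ltnS.
by rewrite (coef_ptruncM _ _ le_in) (coef_ptrunc (pseries_mul f g) le_in).
Qed.

Fact pseries_mul1 : left_id pseries1 pseries_mul.
Proof.
move=> f; apply: pseries_eq => n /=; rewrite big_ord_recl /= mul1r subn0.
by rewrite big1 ?addr0 // => i _; rewrite mul0r.
Qed.

Fact pseries_mulDl : left_distributive pseries_mul pseries_add.
Proof.
move=> f g h; apply: pseries_eq => n /=; rewrite -big_split /=.
by apply: eq_bigr => i _; rewrite mulrDl.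
Qed.

Fact pseries_1neq0 : pseries1 != pseries0.
Proof.
apply/eqP => /(congr1 (fun f => pcoef f 0)) /eqP.
by rewrite /= oner_eq0.
Qed.

HB.instance Definition _ := GRing.Zmodule_isComNzRing.Build pseries
  pseries_mulA pseries_mulC pseries_mul1 pseries_mulDl pseries_1neq0.

Fact pseries_idomain (f g : pseries) : f * g = 0 -> (f == 0) || (g == 0).
Proof.
move=> fg0; apply: contrapT => /negP; rewrite negb_or => /andP[f0 g0].
have nz (z : pseries) : z != 0 -> exists n, pcoef z n != 0.
  move=> z0; apply: contrapT => /forallNP hz; case/eqP: z0.
  by apply: pseries_eq => n; apply/eqP/negPn/negP; exact: hz.
case: (ex_minnP (nz _ f0)) => a fa mina; case: (ex_minnP (nz _ g0)) => b gb minb.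
have := congr1 (fun z => pcoef z (a + b)%N) fg0 => /=.
have lea : (a < (a + b).+1)%N by rewrite ltnS leq_addr.
rewrite (bigD1 (Ordinal lea)) //= addKn big1 => [|i nia].
  by rewrite addr0 => /eqP; rewrite mulf_eq0 (negPf fa) (negPf gb).
have [lia|] := ltnP i a.
  have [->|/mina] := eqVneq (pcoef f i) 0; first by rewrite mul0r.
  by rewrite leqNgt lia.
rewrite leq_eqVlt eq_sym => /predU1P[eia|lai].
  by case/eqP: nia; exact: val_inj.
have [->|/minb] := eqVneq (pcoef g (a + b - i)%N) 0; first by rewrite mulr0.
have le_iab : (i <= a + b)%N by rewrite -ltnS.
by rewrite leq_subRL // leq_add2r leqNgt lai.
Qed.

Definition pseries_unit : pred pseries := fun x => `[< exists y, y * x = 1 >].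
Definition pseries_inv (x : pseries) : pseries :=
  if pselect (exists y, y * x = 1) is left e then projT1 (cid e) else x.

Fact pseries_mulVr : {in pseries_unit, left_inverse 1 pseries_inv *%R}.
Proof.
move=> x /asboolP hx; rewrite /pseries_inv; case: pselect => // e.
exact: (projT2 (cid e)).
Qed.
Fact pseries_unitP (x y : pseries) : y * x = 1 -> pseries_unit x.
Proof. by move=> yx; apply/asboolP; exists y. Qed.
Fact pseries_inv_out : {in [predC pseries_unit], pseries_inv =1 id}.
Proof.
by move=> x /asboolP hx; rewrite /pseries_inv; case: pselect.
Qed.

HB.instance Definition _ := GRing.ComNzRing_hasMulInverse.Build pseries
  pseries_mulVr pseries_unitP pseries_inv_out.
HB.instance Definition _ := GRing.ComUnitRing_isIntegral.Build pseries
  pseries_idomain.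

Definition laurent := {fraction pseries}.
HB.instance Definition _ := GRing.Field.on laurent.

End PowerSeries.

Variant local_field : Type :=
| PadicExt (p : prime_nat) (L : fieldExtType (padic p))
| LaurentField (k : finFieldType).

Definition lf_field (F : local_field) : fieldType :=
  match F with
  | PadicExt _ L => L
  | LaurentField k => laurent k
  end.
Coercion lf_field : local_field >-> fieldType.

(* The integral closure of Z_p in a finite extension of Q_p, and k[[t]] in   *)
(* k((t)).                                                                   *)
Definition integers (F : local_field) : set F :=
  match F return set (lf_field F) with
  | PadicExt p L =>
      [set x : L | integralOver
        (fun z : padic_int p => (FracField.tofrac z : padic p)%:A : L) x]
  | LaurentField k =>
      [set x : laurent k | exists f : pseries k, x = FracField.tofrac f]
  end.

Section SubringsOfFields.
Variables (F : fieldType) (R : set F).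

Definition is_ideal (I : set F) : Prop :=
  [/\ (I `<=` R)%classic, I 0, (forall x y, I x -> I y -> I (x + y))
    & (forall r x, R r -> I x -> I (r * x))].

Definition is_maximal_ideal (I : set F) : Prop :=
  [/\ is_ideal I, I <> R &
      forall J, is_ideal J -> (I `<=` J)%classic -> J = I \/ J = R].

Definition ideal_generator (I : set F) (x : F) : Prop :=
  R x /\ I = [set r * x | r in R]%classic.

Definition is_unit (u : F) : Prop := [/\ R u, u != 0 & R u^-1].

Definition is_nonsquare_unit (u : F) : Prop :=
  is_unit u /\ ~ (exists v, is_unit v /\ u = v ^+ 2).

(* R / I has exactly n elements. *)
Definition quotient_card (I : set F) (n : nat) : Prop :=
  exists r : 'I_n -> F,
    (forall i, R (r i)) /\ (forall x, R x -> exists! i, I (x - r i)).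

(* R / I has characteristic l, for a prime l. *)
Definition quotient_char (I : set F) (l : nat) : Prop :=
  prime l /\ I l%:R.

End SubringsOfFields.

(* S represents each coset of {1, -1} in F^x exactly once. *)
Definition is_sign_representatives (F : fieldType) (S : set F) : Prop :=
  ~ S 0 /\ forall s, s != 0 -> exists! r, S r /\ (r = s \/ r = - s).

Record unital_algebra (F : fieldType) := UnitalAlgebra {
  alg_sort :> lmodType F;
  alg_mul : alg_sort -> alg_sort -> alg_sort;
  alg_one : alg_sort;
  alg_mul_linearl : forall y, linear (fun x => alg_mul x y);
  alg_mul_linearr : forall x, linear (alg_mul x);
  alg_mul1x : left_id alg_one alg_mul;
  alg_mulx1 : right_id alg_one alg_mul
}.

Definition alg_isomorphic (F : fieldType) (A B : unital_algebra F) : Prop :=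
  exists f : A -> B,
    [/\ linear f, bijective f &
        forall x y, f (alg_mul x y) = alg_mul (f x) (f y)].

Definition left_nucleus (F : fieldType) (A : unital_algebra F) : set A :=
  [set x | forall y z, alg_mul (alg_mul x y) z = alg_mul x (alg_mul y z)].

Arguments left_nucleus {F} A _.

Definition has_left_nucleus (F : fieldType) (A : unital_algebra F)
    (K : fieldExtType F) : Prop :=
  exists f : K -> A,
    [/\ linear f, injective f, (forall x y, f (x * y) = alg_mul (f x) (f y))
      & range f = left_nucleus A].

Section Quaternion.
Variables (F : fieldType) (K : fieldExtType F) (sigma : {lrmorphism K -> K}).
Variable a : K.

(* The pair (k, l) stands for k + l t. *)
Definition quat_mul (x y : K * K) : K * K :=
  (x.1 * y.1 + x.2 * sigma y.2 * a, x.1 * y.2 + x.2 * sigma y.1).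

Fact quat_mul_linearl y : linear (fun x => quat_mul x y).
Proof.
move=> c [x1 x2] [z1 z2]; case: y => y1 y2.
rewrite /quat_mul; congr pair; rewrite /= !mulrDl -!scalerAl scalerDr addrACA //.
Qed.

Fact quat_mul_linearr x : linear (quat_mul x).
Proof.
move=> c [y1 y2] [z1 z2]; case: x => x1 x2; rewrite /quat_mul; congr pair.
  rewrite /= linearP /= !mulrDr mulrDl -!scalerAr -!scalerAl scalerDr addrACA //.
by rewrite /= linearP /= !mulrDr -!scalerAr scalerDr addrACA.
Qed.

Fact quat_mul1x : left_id ((1, 0) : K * K) quat_mul.
Proof. by case=> k l; rewrite /quat_mul /= !mul1r !mul0r !addr0. Qed.

Fact quat_mulx1 : right_id ((1, 0) : K * K) quat_mul.
Proof.
by case=> k l; rewrite /quat_mul /= rmorph0 rmorph1 !mulr1 !mulr0 mul0r addr0 add0r.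
Qed.

Definition quaternion_algebra : unital_algebra F :=
  UnitalAlgebra quat_mul_linearl quat_mul_linearr quat_mul1x quat_mulx1.

End Quaternion.

(* K/F is quadratic and s generates its group of automorphisms, which makes  *)
(* K/F Galois (s is bijective since it is injective and F-linear).           *)
Definition is_quadratic_galois (F : fieldType) (K : fieldExtType F)
    (s : {lrmorphism K -> K}) : Prop :=
  \dim {:K} = 2%N /\ (exists x, s x <> x).

Definition is_nonassoc_quaternion (F : fieldType) (A : unital_algebra F) :=
  exists (K : fieldExtType F) (s : {lrmorphism K -> K}) (a : K),
    [/\ is_quadratic_galois s, a \notin 1%VS
      & alg_isomorphic A (quaternion_algebra s a)].

Definition classifies_quaternions (F : fieldType) (K : fieldExtType F)
    (s : {lrmorphism K -> K}) (S : set K) : Prop :=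
  [/\ forall a, S a -> is_nonassoc_quaternion (quaternion_algebra s a) /\
                       has_left_nucleus (quaternion_algebra s a) K,
      forall a b, S a -> S b ->
        alg_isomorphic (quaternion_algebra s a) (quaternion_algebra s b) ->
        a = b
    & forall A : unital_algebra F,
        is_nonassoc_quaternion A -> has_left_nucleus A K ->
        exists a, S a /\ alg_isomorphic A (quaternion_algebra s a)].

Definition is_adjoin_sqrt (F : fieldType) (K : fieldExtType F) (d : F) (r : K)
    : Prop :=
  r ^+ 2 = d%:A /\ <<1; r>>%VS = {:K}%VS.

(* Main.v *)
Require Import Defs.
From HB Require Import structures.
From mathcomp Require Import all_boot all_order all_algebra fingroup cyclic.
From mathcomp Require Import falgebra fieldext finfield.
From mathcomp Require Import boolp classical_sets.
From mathcomp Require Import ring zify.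

Set Implicit Arguments.
Unset Strict Implicit.
Unset Printing Implicit Defensive.

Import GRing.Theory Pdiv.CommonRing.
Local Open Scope ring_scope.

(** Let r be the chosen square root in K, so that sigma r = - r, and write
    a = u + v r.  An isomorphism from (K/F, sigma, a) to (K/F, sigma, b) must
    respect left nuclei and therefore has the form k + l t |-> h k + h l c t,
    with h an automorphism of K/F and c in K; it exists if and only if
    h a = c (sigma c) b.  Up to isomorphism, a is thus determined up to
    multiplication by a norm n = x^2 - d y^2 and up to the sign of v
    ([quaternion_iso_coord]).  If F^x consists of the two norm classes of 1
    and e, a nonzero u can be scaled to 1 or to e, which leaves v up to sign;
    if u = 0, then v can be scaled to 1 or to e, and -- because v may also be
    negated -- to 1 alone when -1 is not a norm.  These are the families of
    [classifies_neg1_norm] and [classifies_neg1_not_norm].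

    What remains is the arithmetic of F: the norm classes are represented by
    1 and a uniformizer if K is generated by the square root of a nonsquare
    unit, and by 1 and any nonsquare unit if K is generated by the square root
    of a uniformizer.  This follows by counting square classes in the residue
    field, from three properties of the ring of integers R ([henselian]): it is
    a valuation ring, its valuation is discrete, and every element close to 1
    is a square.

    The three properties are proved together for Z_p in a finite extension and
    for F_q[[t]] in its fraction field, that is, for the integral closure of a
    complete discrete valuation ring A in an algebraic extension of its
    fraction field.  A root x of a primitive polynomial f over A is a root of
    one of the two factors in [hensel_factor], one of which makes x integral
    and the other 1/x.  Discreteness is read off from the same polynomials.
    Finally, if an element u close to 1 had no square root w, then in the
    quadratic extension containing w the elements (1 - w)/(1 + w) and
    (1 + w)/(1 - w) would be conjugate, hence both integral, whereas their sum
    2 (1 + u)/(1 - u) is not.  In this way the valuation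
    property in all algebraic extensions yields Hensel's lemma for R. *)

(** * Hensel factorization in a complete discrete valuation ring *)

Definition divides (A : comNzRingType) (c a : A) := exists b, a = c * b.

Record complete_dvr (A : idomainType) (pi : A) : Prop := CompleteDvr {
  cdvr_neq0 : pi != 0;
  cdvr_nonunit : pi \isn't a GRing.unit;
  cdvr_factor : forall a, a != 0 ->
    exists m u, u \is a GRing.unit /\ a = pi ^+ m * u;
  cdvr_complete : forall x : nat -> A,
    (forall m, divides (pi ^+ m.+1) (x m.+1 - x m)) ->
    exists y, forall m, divides (pi ^+ m.+1) (y - x m)
}.

Section Divides.
Variables (A : comNzRingType) (c : A).
Lemma divides0 : divides c 0. Proof. by exists 0; rewrite mulr0. Qed.
Lemma dividesD a b : divides c a -> divides c b -> divides c (a + b).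
Proof. by case=> x -> [y ->]; exists (x + y); rewrite mulrDr. Qed.
Lemma dividesN a : divides c a -> divides c (- a).
Proof. by case=> x ->; exists (- x); rewrite mulrN. Qed.
Lemma dividesB a b : divides c a -> divides c b -> divides c (a - b).
Proof. by move=> ca /dividesN; apply: dividesD. Qed.
Lemma divides_coefs (f : {poly A}) :
  (forall i, divides c f`_i) -> exists g, f = c *: g.
Proof.
move=> /choice[b bE]; exists (\poly_(i < size f) b i); apply/polyP => i.
by rewrite coefZ coef_poly; case: ltnP => // ?; rewrite nth_default ?mulr0.
Qed.
End Divides.

Lemma rdivp_monicZ (A : comNzRingType) (c : A) (e g : {poly A}) :
  g \is monic -> rdivp (c *: e) g = c *: rdivp e g.
Proof.
move=> mg; apply: (monic_rreg mg).
have := Pdiv.RingMonic.rdivp_eq mg (c *: e).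
rewrite {1}(Pdiv.RingMonic.rdivp_eq mg e) Pdiv.RingMonic.rmodpZ // scalerDr.
by move/addIr => <-; rewrite scalerAl.
Qed.

Section CompleteDvr.
Variables (A : idomainType) (pi : A).
Hypothesis dvr : complete_dvr pi.

Lemma nonunit_divides a : a \isn't a GRing.unit -> divides pi a.
Proof.
have [->|a0] := eqVneq a 0; first by move=> _; exact: divides0.
have [[|m] [u [uu ->]]] := cdvr_factor dvr a0; first by rewrite expr0 mul1r uu.
by move=> _; exists (pi ^+ m * u); rewrite exprS mulrA.
Qed.

Lemma divides_nonunit a : divides pi a -> a \isn't a GRing.unit.
Proof. by case=> b ->; rewrite unitrM (negPf (cdvr_nonunit dvr)). Qed.

(** Non-units are the multiples of [pi], so adding one preserves units. *)
Lemma unit_near u v : u \is a GRing.unit -> divides pi (v - u) -> v \is a GRing.unit.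
Proof.
move=> uu vu; apply: contraT => /nonunit_divides/dividesB/(_ vu).
by rewrite subKr => /divides_nonunit; rewrite uu.
Qed.

Lemma divides_all a : (forall m, divides (pi ^+ m.+1) a) -> a = 0.
Proof.
move=> h; apply: contraTeq isT => a0.
have [m [u [uu aE]]] := cdvr_factor dvr a0.
have [b] := h m; rewrite {}aE exprSr -mulrA => /mulfI ub.
have /divides_nonunit : divides pi u by exists b; apply: ub; rewrite expf_neq0 ?cdvr_neq0.
by rewrite uu.
Qed.

Lemma poly_complete n (G : nat -> {poly A}) : (forall m, (size (G m) <= n)%N) ->
  (forall m i, divides (pi ^+ m.+1) (G m.+1 - G m)`_i) ->
  exists2 g : {poly A}, (size g <= n)%N & forall m i, divides (pi ^+ m.+1) (g - G m)`_i.
Proof.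
move=> szG dG.
have /choice[y yP] i : exists y, forall m, divides (pi ^+ m.+1) (y - (G m)`_i).
  by apply: (cdvr_complete dvr) => m; rewrite -coefB.
exists (\poly_(i < n) y i) => [|m i]; first exact: size_poly.
rewrite coefB coef_poly; case: ltnP => // le_ni.
by rewrite nth_default ?subr0 ?(leq_trans (szG m)) //; exact: divides0.
Qed.

Section Factor.
Variables (f : {poly A}) (k : nat).
Hypothesis fk_unit : f`_k \is a GRing.unit.
Hypothesis f_high : forall i, (k < i)%N -> divides pi f`_i.

(** One refinement of an approximate factorization f = g * h with g monic and h
   congruent to the constant f_k.  Dividing the error as e = b * g + a, the
   pair (g + a / f_k, h + b) has error a * (1 - h / f_k) - a * b / f_k, which
   is divisible by one more power of pi. *)
Let step (gh : {poly A} * {poly A}) :=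
  let e := f - gh.1 * gh.2 in
  (gh.1 + (f`_k)^-1 *: rmodp e gh.1, gh.2 + rdivp e gh.1).

Let approx m := iter m step ((f`_k)^-1 *: take_poly k.+1 f, (f`_k)%:P).

Let k_lt : (k < size f)%N.
Proof.
rewrite ltnNge; apply/negP => /(nth_default 0) fk0.
by move: fk_unit; rewrite fk0 unitr0.
Qed.

Let approxP m : let g := (approx m).1 in let h := (approx m).2 in
  [/\ g \is monic, size g = k.+1, (size h <= size f - k)%N,
      forall i, divides pi (h - (f`_k)%:P)`_i &
      exists e, f - g * h = pi ^+ m.+1 *: e].
Proof.
elim: m => [|m]; rewrite /approx /=.
  have szt : size (take_poly k.+1 f) = k.+1.
    apply/eqP; rewrite eqn_leq size_take_poly /=.
    rewrite ltnNge; apply/negP => /(nth_default 0).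
    rewrite coef_take_poly ltnSn => fk0.
    by move: fk_unit; rewrite fk0 unitr0.
  have szg : size ((f`_k)^-1 *: take_poly k.+1 f) = k.+1.
    rewrite size_scale ?invr_eq0 //.
    by apply: contraTneq fk_unit => ->; rewrite unitr0.
  split=> //.
  - apply/eqP; rewrite lead_coefE szg /= coefZ coef_take_poly ltnSn.
    by rewrite mulVr.
  - by rewrite (leq_trans (size_polyC_leq1 _)) // subn_gt0.
  - by move=> i; rewrite subrr coef0; exact: divides0.
  - rewrite expr1; apply: divides_coefs => i.
    rewrite mulrC mul_polyC scalerA divrr // scale1r coefB coef_take_poly.
    by case: ltnP => [_|/f_high]; rewrite ?subrr ?subr0 //; exact: divides0.
rewrite -/(approx m); case: (approx m) => g h /= [mg szg szh hk [e eE]].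
rewrite eE Pdiv.RingMonic.rmodpZ //.
rewrite rdivp_monicZ //.
set a := rmodp e g; set b := rdivp e g.
have e0 : e = b * g + a by exact: Pdiv.RingMonic.rdivp_eq.
have sza : (size a < size g)%N by rewrite ltn_rmodp monic_neq0.
have sze : (size (pi ^+ m.+1 *: e) <= size f)%N.
  rewrite -eE (leq_trans (size_polyD _ _)) // geq_max leqnn /= size_polyN.
  rewrite (leq_trans (size_polyMleq _ _)) // szg /=.
  by rewrite (leq_trans (leq_add (leqnn k) szh)) // subnKC // ltnW.
have szga : size (g + (f`_k)^-1 *: (pi ^+ m.+1 *: a)) = k.+1.
  rewrite size_polyDl // (leq_ltn_trans (size_scale_leq _ _)) //.
  by rewrite (leq_ltn_trans (size_scale_leq _ _)).
split=> //.
- rewrite monicE lead_coefDl ?(monicP mg) //.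
  rewrite (leq_ltn_trans (size_scale_leq _ _)) //.
  by rewrite (leq_ltn_trans (size_scale_leq _ _)).
- rewrite (leq_trans (size_polyD _ _)) // geq_max szh /=.
  have pn0 : pi ^+ m.+1 != 0 by rewrite expf_neq0 ?cdvr_neq0.
  rewrite size_scale // in sze.
  rewrite size_scale //.
  have [->|b0] := eqVneq b 0; first by rewrite size_poly0.
  have szbg : size (b * g) = (size b + k)%N.
    by rewrite size_Mmonic // szg addnS.
  have : (size (b * g)%R <= maxn (size e) (size a))%N.
    by rewrite -(addrK a (b * g)) -e0 -(size_polyN a) size_polyD.
  have b1 : (0 < size b)%N by rewrite size_poly_gt0.
  rewrite szbg leq_max orbC leqNgt (leq_trans sza) /=; last first.
    by rewrite szg -{1}add1n leq_add2r.
  by move=> bk; rewrite leq_subRL ?(ltnW k_lt) // addnC (leq_trans bk).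
- move=> i; rewrite addrAC coefD; apply: dividesD => //.
  by rewrite coefZ exprS -mulrA; exists (pi ^+ m * b`_i).
- have [h' hE] := divides_coefs hk.
  exists (- (a * ((f`_k)^-1 *: h')) - (f`_k)^-1 *: (pi^+m *: (a * b))).
  have hfE : h = (f`_k)%:P + pi *: h' by rewrite -hE addrC subrK.
  have cF : ((f`_k)^-1)%:P * (f`_k)%:P = 1 :> {poly A} by rewrite -polyCM mulVr.
  transitivity ((g * h + pi ^+ m.+1 *: e)
    - (g + (f`_k)^-1 *: (pi ^+ m.+1 *: a)) * (h + pi ^+ m.+1 *: b)).
    by congr (_ - _); rewrite -eE addrC subrK.
  move: hfE cF; rewrite e0 -!mul_polyC !polyC_exp.
  move: (pi%:P) ((f`_k)^-1%:P) ((f`_k)%:P) => P c F -> cF.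
  transitivity (P ^+ m.+2 * (- (a * (c * h')) - c * (P ^+ m * (a * b)))
                + (1 - c * F) * (P ^+ m.+1 * a)); first by rewrite !exprS; ring.
  by rewrite cF subrr mul0r addr0.
Qed.

(** Modulo [pi], the polynomial f has degree k with unit leading coefficient,
    so it is the product of a monic polynomial of degree k and the constant f_k.
    These are coprime because the second is a unit, and the factorization lifts;
    h ends up with constant coefficient congruent to f_k. *)
Lemma hensel_factor : exists g h : {poly A},
  [/\ g \is monic, h`_0 \is a GRing.unit & f = g * h].
Proof.
have cv m : let gh := approx m in let gh' := approx m.+1 in
  (forall i, divides (pi ^+ m.+1) (gh'.1 - gh.1)`_i) /\
  (forall i, divides (pi ^+ m.+1) (gh'.2 - gh.2)`_i).
  have [mg _ _ _ [e eE]] := approxP m.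
  rewrite /= -/(approx m) eE [_.1 + _]addrC [_.2 + _]addrC !addrK.
  split=> i; last by exists (rdivp e (approx m).1)`_i; rewrite rdivp_monicZ // coefZ.
  rewrite Pdiv.RingMonic.rmodpZ // scalerA mulrC -scalerA coefZ.
  by exists ((f`_k)^-1 *: rmodp e (approx m).1)`_i.
have [g szg gE] := @poly_complete k.+1 (fun m => (approx m).1)
  (fun m => eq_leq (let: And5 _ s _ _ _ := approxP m in s)) (fun m => (cv m).1).
have [h szh hE] := @poly_complete (size f - k)%N (fun m => (approx m).2)
  (fun m => let: And5 _ _ s _ _ := approxP m in s) (fun m => (cv m).2).
exists g, h; split.
- have gk : g`_k = 1.
    apply/eqP; rewrite -subr_eq0; apply/eqP/divides_all => m.
    have [mg szgm _ _ _] := approxP m.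
    have := gE m k; rewrite coefB; congr (divides _ (_ - _)).
    by rewrite -(monicP mg) lead_coefE szgm.
  have szg' : size g = k.+1.
    apply/eqP; rewrite eqn_leq szg /= ltnNge; apply/negP => /(nth_default 0).
    by rewrite gk => /eqP; rewrite oner_eq0.
  by rewrite monicE lead_coefE szg' gk.
- apply: unit_near fk_unit _.
  by have := hE 0 0; rewrite coefB coefC.
- apply/polyP => i; apply/eqP; rewrite -subr_eq0 -coefB; apply/eqP/divides_all => m.
  have [_ _ _ _ [e eE]] := approxP m.
  have /divides_coefs[a aE] := gE m; have /divides_coefs[b bE] := hE m.
  have -> : f - g * h = pi ^+ m.+1 *: (e - a * h - (approx m).1 * b).
    rewrite !scalerBr scalerAl scalerAr -eE -aE -bE; ring.
  by rewrite coefZ; exists (e - a * h - (approx m).1 * b)`_i.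
Qed.
End Factor.
End CompleteDvr.

(** * The p-adic integers and the formal power series *)

(** The part of [complete_dvr] that does not speak of units: it is what can be
    checked on coefficients, and it yields the units through [unit_mod]. *)
Definition complete_separated (A : idomainType) (pi : A) : Prop :=
  (forall x : nat -> A,
    (forall m, divides (pi ^+ m.+1) (x m.+1 - x m)) ->
    exists y, forall m, divides (pi ^+ m.+1) (y - x m)) /\
  (forall a, (forall m, divides (pi ^+ m.+1) a) -> a = 0).

(** If a c = 1 - pi b, then c times the geometric series in pi b is an inverse
    of a. *)
Lemma unit_mod (A : idomainType) (pi a c : A) :
  complete_separated pi -> divides pi (1 - a * c) -> a \is a GRing.unit.
Proof.
case=> complete separated [b bE].
pose x := fun m => iteri m (fun i y => y + c * (pi * b) ^+ i) 0.
have xE m : 1 - a * x m = (pi * b) ^+ m.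
  elim: m => [|m IH]; first by rewrite mulr0 subr0.
  rewrite [x m.+1]/(x m + c * (pi * b) ^+ m).
  by rewrite mulrDr opprD addrA IH mulrA exprS -bE mulrBl mul1r.
have [m|y yP] := complete (fun m => x m.+1).
  rewrite [x m.+2]/(x m.+1 + c * (pi * b) ^+ m.+1) addrC addKr exprMn.
  by exists (c * b ^+ m.+1); rewrite mulrCA.
suff ya : y * a = 1 by apply/unitrP; exists y; rewrite [a * y]mulrC.
apply/eqP; rewrite -subr_eq0; apply/eqP/separated => m.
have [d dE] := yP m.
have -> : y * a - 1 = (y - x m.+1) * a - (1 - a * x m.+1) by ring.
by rewrite xE dE exprMn; exists (d * a - b ^+ m.+1); rewrite mulrBr mulrA.
Qed.

Section Padic.
Variable p : prime_nat.
Local Notation q n := (sval p ^ n.+1)%N.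
Local Notation Zp := (padic_int p).

Let p_pr : prime (sval p) := svalP p.

Lemma padic_natrE n k : ((k%:R : Zp) n : nat) = (k %% q n)%N.
Proof.
have -> : (k%:R : Zp) n = (k%:R : 'Z_(q n)).
  by elim: k => // k IH; rewrite !mulrS -IH.
by rewrite val_Zp_nat // padic_mod_gt1.
Qed.

Lemma padic_ltn (z : Zp) n : (z n < q n)%N.
Proof.
by have := ltn_ord (z n); rewrite [X in (_ < X)%N -> _]Zp_cast // padic_mod_gt1.
Qed.

Lemma padic_le0 (z : Zp) n m : (n <= m)%N -> (z n == 0) = (q n %| z m)%N.
Proof.
move=> le; rewrite padic_eq0 /dvdn -(padic_coherent_le z le) //.
Qed.

Lemma padic_valM (x y : Zp) n : ((x * y)%R n : nat) = (x n * y n %% q n)%N.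
Proof. by rewrite /= padic_val_mod. Qed.

(** Residues are taken modulo p ^ n.+1, hence the shift of the exponent.  The
    n-th residue of the quotient is read off m.+1 places further on in z. *)
Lemma padic_dividesP (z : Zp) m :
  divides ((sval p)%:R ^+ m.+1) z <-> z m = 0.
Proof.
split=> [[b ->]|zm].
  apply/eqP; rewrite padic_eq0 padic_valM -natrX padic_natrE modnn mul0n mod0n.
  exact: dvdn0.
have zdv n : (q m %| z (n + m.+1))%N.
  by rewrite -padic_le0 ?zm // addnS ltnW // ltnS leq_addl.
have q_gt0 n : (0 < q n)%N by rewrite expn_gt0 prime_gt0.
pose y n : 'Z_(q n) := inZp (z (n + m.+1)%N %/ q m).
have yE n : (y n : nat) = (z (n + m.+1) %/ q m %% q n)%N.
  by rewrite /= padic_val_mod.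
have ylt n : (z (n + m.+1) %/ q m < q n)%N.
  by rewrite ltn_divLR // -expnD addSn padic_ltn.
have cy : coherent y.
  move=> n; rewrite !yE modn_mod (modn_small (ylt n.+1)) !modn_divl.
  by rewrite -expnD; congr (_ %/ _)%N; exact: (padic_coherent z (n + m.+1)).
exists (PadicInt cy); apply: padic_int_eq => n; apply: val_inj.
rewrite [RHS]padic_valM -natrX padic_natrE [padic_res _ n]/= yE modnMml modnMmr.
rewrite muln_divA // mulKn // padic_coherent_le ?leq_addr //.
by rewrite modn_small ?padic_ltn.
Qed.

Lemma padic_complete_separated : complete_separated ((sval p)%:R : Zp).
Proof.
split=> [x dx|a da]; last first.
  by apply: padic_int_eq => n; apply/padic_dividesP.
have xS n : (x n.+1 n : nat) = x n n.
  have /padic_dividesP dn := dx n.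
  have : x n.+1 n = x n n :> 'Z_(q n).
    by apply/eqP; rewrite -subr_eq0; apply/eqP.
  by move=> ->.
have cy : coherent (fun n => x n n).
  by move=> n; rewrite padic_coherent xS.
exists (PadicInt cy) => m; apply/padic_dividesP.
exact: subrr.
Qed.

(** A p-adic integer with nonzero residue mod p is a unit by the extended
    Euclidean algorithm; the least n with a nonzero residue mod p ^ n.+1 is
    the valuation. *)
Lemma padic_complete_dvr : complete_dvr ((sval p)%:R : Zp).
Proof.
have p1 : (1 < sval p)%N by exact: prime_gt1.
have pn0 : ((sval p)%:R : Zp) != 0.
  apply/eqP => /(congr1 (fun z : Zp => z 1%N : nat)).
  rewrite padic_natrE modn_small; last by rewrite -{1}(expn1 (sval p)) ltn_exp2l.
  by move=> e; rewrite [RHS]/= in e; rewrite e in p1.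
have unit0 (a : Zp) : a 0%N != 0 -> a \is a GRing.unit.
  rewrite padic_eq0 -prime_coprime ?expn1 // => co.
  apply: (unit_mod (c := (egcdn (a 0%N) (sval p)).1%:R) padic_complete_separated).
  rewrite -[X in divides X _]expr1; apply/padic_dividesP.
  have a0 : (0 < a 0%N)%N.
    case: posnP co => // ->; rewrite /coprime gcdn0 => /eqP p1'.
    by rewrite -(expn1 (sval p)) p1' in p1.
  case: (egcdnP (sval p) a0) => u v /= uE _.
  apply/eqP; rewrite subr_eq0 eq_sym; apply/eqP/val_inj.
  rewrite [LHS]padic_valM padic_natrE modnMmr mulnC uE gcdnC.
  rewrite (eqP co) modnMDl /= padic_val_mod //.
have sub (a : Zp) : a != 0 -> exists n, a n != 0.
  move=> a0; apply: contrapT => /forallNP h; case/eqP: a0.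
  by apply: padic_int_eq => n; apply/eqP/negPn/negP; apply: h.
split=> //; last by case: padic_complete_separated.
- apply/negP => /unitrP[y [yp _]].
  have /padic_dividesP : divides ((sval p)%:R ^+ 1) (1 : Zp).
    by exists y; rewrite expr1 mulrC yp.
  by move/eqP; rewrite oner_eq0.
- move=> a /sub an; case: (ex_minnP an) => [[|m]] am mmin.
    by exists 0%N, a; rewrite unit0 // expr0 mul1r.
  have /padic_dividesP[b aE] : a m = 0.
    by apply: contraTeq isT => /mmin; rewrite ltnn.
  exists m.+1, b; split=> //; apply: unit0; apply: contraNneq am => b0.
  have /padic_dividesP[c bE] := b0.
  by apply/eqP/padic_dividesP; exists c; rewrite aE bE mulrA expr1 -exprSr.
Qed.
End Padic.

Section Series.
Variable k : fieldType.
Local Notation S := (pseries k).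

Definition pseriesX : S := PSeries (fun n => (n == 1%N)%:R).

Lemma coef_pseriesXM (f : S) n :
  pcoef (pseriesX * f) n = if n is n'.+1 then pcoef f n' else 0.
Proof.
case: n => [|n]; first by rewrite /= big_ord1 mul0r.
rewrite /= (bigD1 (@Ordinal n.+2 1 isT)) //= mul1r subn1 /= big1 ?addr0 // => i.
rewrite -val_eqE /= => /negPf ->; by rewrite mul0r.
Qed.

Lemma coef_pseriesXnM (f : S) m n :
  pcoef (pseriesX ^+ m * f) n = if (n < m)%N then 0 else pcoef f (n - m)%N.
Proof.
elim: m n => [|m IH] n; first by rewrite expr0 mul1r subn0.
by rewrite exprS -mulrA coef_pseriesXM; case: n => // n; rewrite IH ltnS.
Qed.

Lemma pseries_dividesP (f : S) m :
  divides (pseriesX ^+ m) f <-> forall i, (i < m)%N -> pcoef f i = 0.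
Proof.
split=> [[b ->] i im|f0]; first by rewrite coef_pseriesXnM im.
exists (PSeries (fun n => pcoef f (n + m)%N)); apply: pseries_eq => n.
by rewrite coef_pseriesXnM; case: ltnP => [/f0//|le] /=; rewrite subnK.
Qed.

Lemma pseries_complete_separated : complete_separated pseriesX.
Proof.
split=> [x dx|a da]; last first.
  by apply: pseries_eq => n; have /pseries_dividesP := da n; apply.
exists (PSeries (fun n => pcoef (x n) n)) => m; apply/pseries_dividesP => i.
rewrite ltnS => im; rewrite /= -(subnKC im).
elim: (m - i)%N => [|d IH]; first by rewrite addn0 subrr.
have /pseries_dividesP/(_ i) := dx (i + d)%N.
rewrite ltnS leq_addr /= => /(_ isT)/eqP; rewrite subr_eq0 => /eqP h.
by rewrite addnS h.
Qed.

Lemma pseries_complete_dvr : complete_dvr pseriesX.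
Proof.
have unit0 (a : S) : pcoef a 0%N != 0 -> a \is a GRing.unit.
  move=> a0; pose c : S := PSeries (fun n => if n is 0%N then (pcoef a 0%N)^-1 else 0).
  apply: (unit_mod (c := c) pseries_complete_separated).
  rewrite -[X in divides X _]expr1; apply/pseries_dividesP => -[] //= _.
  by rewrite big_ord1 /= mulfV // subrr.
have sub (a : S) : a != 0 -> exists n, pcoef a n != 0.
  move=> a0; apply: contrapT => /forallNP h; case/eqP: a0.
  by apply: pseries_eq => n; apply/eqP/negPn/negP; apply: h.
split=> //; last by case: pseries_complete_separated.
- by apply/eqP => /(congr1 (fun f => pcoef f 1)) /eqP; rewrite /= oner_eq0.
- apply/negP => /unitrP[y [_ yp]].
  have := congr1 (fun f => pcoef f 0) yp.
  by rewrite coef_pseriesXM => /eqP; rewrite eq_sym oner_eq0.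
- move=> a /sub an; case: (ex_minnP an) => m am mmin.
  have /pseries_dividesP[b aE] : forall i, (i < m)%N -> pcoef a i = 0.
    by move=> i; apply: contraTeq => /mmin; rewrite -leqNgt.
  exists m, b; split=> //; apply: unit0.
  by move: am; rewrite aE coef_pseriesXnM ltnn subnn.
Qed.
End Series.

(** * Integral closures of complete discrete valuation rings *)

Lemma fracP (A : idomainType) (x : {fraction A}) :
  exists a b : A, b != 0 /\ x = FracField.tofrac a / FracField.tofrac b.
Proof.
elim/quotW: x => x; exists (frac x).1, (frac x).2.
have d0 := denom_ratioP x; split=> //.
rewrite -[LHS](mulfK (_ : FracField.tofrac (frac x).2 != 0)) ?tofrac_eq0 //.
congr (_ / _); unlock FracField.tofrac; rewrite !piE; apply/eqP.
rewrite piE /equivf /FracField.mulf !numden_Ratio ?mulf_neq0 ?oner_eq0 //.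
by rewrite mulr1 /= mulr1 mulrC.
Qed.

Lemma clear_denominators (A : idomainType) (q : {poly {fraction A}}) :
  exists2 c : A, c != 0 & exists f : {poly A},
    FracField.tofrac c *: q = map_poly (@FracField.tofrac A) f.
Proof.
elim/poly_ind: q => [|q x [c c0 [f fE]]].
  by exists 1; rewrite ?oner_eq0 //; exists 0; rewrite scaler0 rmorph0.
have [a [b [b0 ->]]] := fracP x.
exists (c * b); first by rewrite mulf_neq0.
exists (b *: f * 'X + (c * a)%:P).
have -> : map_poly (@FracField.tofrac A) (b *: f * 'X + (c * a)%:P) =
    FracField.tofrac b *: (FracField.tofrac c *: q) * 'X + (FracField.tofrac (c * a))%:P.
  rewrite rmorphD [in LHS]rmorphM /= map_polyX map_polyC /=.
  by rewrite map_polyZ -fE.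
rewrite scalerDr !scalerA !rmorphM /= [_ b * _]mulrC -scalerAl; congr (_ + _).
rewrite -mul_polyC -!polyCM; congr (_%:P).
by field; rewrite tofrac_eq0.
Qed.

Section IntegralClosure.
Variables (A : idomainType) (pi : A).
Hypothesis dvr : complete_dvr pi.

(** Dividing out [pi] lowers the valuation of the leading coefficient, so this
    must stop. *)
Lemma primitive_part (f : {poly A}) : f != 0 ->
  exists m f', f = pi ^+ m *: f' /\ exists i, f'`_i \is a GRing.unit.
Proof.
move=> f0; have := f0; rewrite -lead_coef_eq0 => /(cdvr_factor dvr)[m [u [uu]]].
elim: m f f0 => [|m IH] f f0.
  rewrite expr0 mul1r => fu; exists 0%N, f; rewrite expr0 scale1r; split=> //.
  by exists (size f).-1; rewrite -lead_coefE fu.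
move=> lf; have [[i fi]|nu] := pselect (exists i, f`_i \is a GRing.unit).
  by exists 0%N, f; rewrite expr0 scale1r; split=> //; exists i.
have [g fE] : exists g, f = pi *: g.
  apply: divides_coefs => i; apply: (nonunit_divides dvr).
  by apply/negP => fi; apply: nu; exists i.
have g0 : g != 0 by apply: contraNneq f0 => g0; rewrite fE g0 scaler0.
have [|n [h [gE hu]]] := IH g g0.
  apply: (mulfI (cdvr_neq0 dvr)); rewrite mulrA -exprS -lf fE.
  by rewrite lead_coefZ.
exists n.+1, h; split=> //; by rewrite fE gE scalerA exprS.
Qed.

Variables (L : fieldType) (j : {rmorphism {fraction A} -> L}).
Hypothesis alg : forall x, algebraicOver j x.
Local Notation iota := (j \o @FracField.tofrac A).
Local Notation R := (integralOver iota).

Lemma iota_eq0 a : (iota a == 0) = (a == 0).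
Proof. by rewrite fmorph_eq0 tofrac_eq0. Qed.

Lemma iota_inj : injective iota.
Proof. by move=> a b /fmorph_inj/eqP; rewrite tofrac_eq => /eqP. Qed.

Lemma primitive_root x : exists f : {poly A},
  (exists i, f`_i \is a GRing.unit) /\ root (map_poly iota f) x.
Proof.
have [q q0 qx] := alg x; have [c c0 [f fE]] := clear_denominators q.
have f0 : f != 0.
  apply: contraNneq q0 => f0; move/eqP: fE.
  by rewrite f0 rmorph0 scaler_eq0 tofrac_eq0 (negPf c0).
have [m [f' [fE' fu]]] := primitive_part f0; exists f'; split=> //.
have : root (map_poly iota f) x.
  rewrite map_poly_comp -fE map_polyZ rootZ //.
  by rewrite fmorph_eq0 tofrac_eq0.
by rewrite fE' map_polyZ rootZ // iota_eq0 expf_neq0 // (cdvr_neq0 dvr).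
Qed.

Lemma integral_exp x n : R x -> R (x ^+ n).
Proof.
move=> Rx; elim: n => [|n IH]; first exact: integral1.
by rewrite exprS; apply: integral_mul.
Qed.

Lemma integral_iota a : R (iota a).
Proof. exact: integral_id. Qed.

Lemma horner_iota (f : {poly A}) x :
  (map_poly iota f).[x] = \sum_(i < size f) iota f`_i * x ^+ i.
Proof.
rewrite (@horner_coef_wide _ (size f)) ?size_poly //.
by apply: eq_bigr => i _; rewrite coef_map.
Qed.

(** The integral closure is a valuation ring.  Cut a primitive equation f of x
    at the last unit coefficient f_k: in f = g h the factor g is monic, and h
    becomes monic after reversal and division by its constant coefficient, so a
    root of g is integral and a root of h has integral inverse. *)
Lemma integral_or_inv x : R x \/ R x^-1.
Proof.
have [f [fu fx]] := primitive_root x.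
have bd i : f`_i \is a GRing.unit -> (i <= size f)%N.
  by apply: contraLR; rewrite -ltnNge => /ltnW/(nth_default 0) ->; rewrite unitr0.
case: (ex_maxnP fu bd) => k fk kmax.
have [i ki|g [h [mg h0 fE]]] := hensel_factor dvr fk.
  apply: (nonunit_divides dvr); apply: contraTN ki => /kmax.
  by rewrite -leqNgt.
move: fx; rewrite fE rmorphM rootM => /orP[gx|hx]; first by left; exists g.
have [->|x0] := eqVneq x 0; first by left; exact: integral0.
right; have hn : h != 0.
  by apply: contraTneq h0 => ->; rewrite coef0 unitr0.
pose n := (size h).-1; have sh : size h = n.+1 by rewrite prednK ?size_poly_gt0.
exists (\poly_(i < n.+1) ((h`_0)^-1 * h`_(n - i)%N)).
  apply/monicP; rewrite lead_coef_poly //= subnn mulVr ?oner_eq0 //.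
have hx0 : \sum_(i < n.+1) iota h`_i * x ^+ i = 0.
  by rewrite -sh -horner_iota; apply/rootP.
apply/rootP; rewrite (@horner_coef_wide _ n.+1); last first.
  by rewrite size_map_inj_poly ?size_poly //; [exact: iota_inj|exact: rmorph0].
transitivity (iota (h`_0)^-1 * x^-1 ^+ n * \sum_(i < n.+1) iota h`_i * x ^+ i);
  last by rewrite hx0 mulr0.
rewrite mulr_sumr [RHS](reindex_inj rev_ord_inj) /=.
apply: eq_bigr => i _; rewrite coef_map coef_poly ltn_ord subSS /= !rmorphM /=.
rewrite -!mulrA; congr (_ * _); rewrite mulrCA; congr (_ * _).
have le_in : (i <= n)%N by rewrite -ltnS.
rewrite -{2}(subnKC le_in) exprD -mulrA -exprMn mulVf // expr1n mulr1 //.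
Qed.

(** A is integrally closed, in the form that says that a non-unit of A stays a
    non-unit: multiply a monic equation of 1/a by a power of a. *)
Lemma integral_inv_iota a : a != 0 -> R (iota a)^-1 -> a \is a GRing.unit.
Proof.
move=> a0 [f mf /rootP fa].
have fn0 := monic_neq0 mf.
pose n := (size f).-1; have sf : size f = n.+1 by rewrite prednK ?size_poly_gt0.
have ia0 : iota a != 0 by rewrite iota_eq0.
have : \sum_(i < n.+1) f`_i * a ^+ (n - i) = 0.
  apply: iota_inj; rewrite rmorph0 -[RHS](mulr0 (iota a ^+ n)) -[X in _ * X]fa.
  rewrite rmorph_sum horner_iota sf mulr_sumr; apply: eq_bigr => i _.
  have le_in : (i <= n)%N by rewrite -ltnS.
  rewrite rmorphM rmorphXn /= mulrCA; congr (_ * _).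
  by rewrite -[X in _ ^+ X * _](subnK le_in) exprD -mulrA -exprMn divff // expr1n mulr1.
rewrite big_ord_recr /= subnn mulr1.
have -> : f`_n = 1 by rewrite -(monicP mf) lead_coefE.
move/eqP; rewrite addr_eq0 => /eqP s1.
apply/unitrP; exists (- \sum_(i < n) f`_i * a ^+ (n - i).-1).
suff ya : - (\sum_(i < n) f`_i * a ^+ (n - i).-1) * a = 1.
  by split; rewrite // mulrC.
rewrite mulNr -[RHS]opprK -s1 mulr_suml; congr (- _); apply: eq_bigr => i _.
by rewrite -mulrA -exprSr prednK // subn_gt0.
Qed.

(** Divide f(x) = 0 by x ^ i.+1: if all other terms are integral, so is the
    i-th, which is f_i / x. *)
Lemma integral_term_of_root (f : {poly A}) x i : x != 0 -> root (map_poly iota f) x ->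
  (forall k, k != i -> R (iota f`_k * x ^+ k / x ^+ i.+1)) -> R (iota f`_i / x).
Proof.
move=> x0 /rootP fx Rk; have [si|si] := leqP (size f) i.
  by rewrite nth_default // rmorph0 mul0r; exact: integral0.
move: fx; rewrite horner_iota (bigD1 (Ordinal si)) //= => /eqP.
rewrite addr_eq0 => /eqP /(congr1 (fun y => y / x ^+ i.+1)).
have -> : iota f`_i * x ^+ i / x ^+ i.+1 = iota f`_i / x.
  by rewrite exprSr invfM mulrA mulfK ?expf_neq0.
move=> ->; rewrite mulNr mulr_suml; apply: integral_opp.
apply: big_ind => [||k ki]; [exact: integral0|exact: integral_add|].
by apply: Rk; apply: contra ki => /eqP ki; apply/eqP/val_inj.
Qed.

Lemma integral_div_exp x m n : x != 0 -> R x -> (n <= m)%N -> R (x ^+ m / x ^+ n).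
Proof.
move=> x0 Rx le; rewrite -(subnK le) exprD mulfK ?expf_neq0 //.
exact: integral_exp.
Qed.

(** c is the lowest nonzero coefficient of an equation of x. *)
Lemma integral_divides_scalar x : x != 0 -> R x -> exists2 c, c != 0 & R (iota c / x).
Proof.
move=> x0 Rx; have [f [[i0 fi0] fx]] := primitive_root x.
have fn0 : exists i, f`_i != 0.
  by exists i0; apply: contraTneq fi0 => ->; rewrite unitr0.
case: (ex_minnP fn0) => i fi imin; exists f`_i => //.
apply: (integral_term_of_root x0 fx) => k ki; have [lt_ki|le_ik] := ltnP k i.
  have -> : f`_k = 0 by apply: contraTeq lt_ki => /imin; rewrite -leqNgt.
  by rewrite rmorph0 !mul0r; exact: integral0.
rewrite -mulrA; apply: integral_mul (integral_iota _) _.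
by apply: integral_div_exp => //; rewrite ltn_neqAle eq_sym ki.
Qed.

(** Discreteness.  If x <> 0 is divisible by all powers of the non-unit v, then
    so is a power of [pi] by [integral_divides_scalar], and hence [pi] itself
    because R is a valuation ring.  In a primitive equation of v, let f_i be the
    first unit coefficient: the coefficients before it are multiples of [pi],
    hence of any power of v, and the terms after it are multiples of
    v ^ i.+1, so v would divide the unit f_i. *)
Lemma integral_separated v x : v != 0 -> R v -> ~ R v^-1 ->
  (forall n, R (x / v ^+ n)) -> x = 0.
Proof.
move=> v0 Rv nRv xv; apply: contrapT => /eqP x0.
have Rx : R x by have := xv 0%N; rewrite expr0 divr1.
have [c c0 cx] := integral_divides_scalar x0 Rx.
have cv n : R (iota c / v ^+ n).
  rewrite -[iota c](divfK x0) -(mulrA _ x); exact: integral_mul cx (xv n).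
have [m [u [uu cE]]] := cdvr_factor dvr c0.
have piv n : R (iota pi ^+ m / v ^+ n).
  have -> : iota pi ^+ m = iota u^-1 * iota c.
    by rewrite -rmorphXn -rmorphM cE mulrCA mulVr // mulr1.
  by rewrite -mulrA; exact: integral_mul (integral_iota _) (cv n).
have pi0 : iota pi != 0 by rewrite iota_eq0 (cdvr_neq0 dvr).
have pv n : R (iota pi / v ^+ n).
  have [//|] := integral_or_inv (iota pi / v ^+ n).
  rewrite invf_div => /(integral_exp m) /integral_mul /(_ (piv (n * m).+1)).
  rewrite expr_div_n -exprM mulrA divfK ?expf_neq0 //.
  by rewrite exprSr invfM mulrA divff ?expf_neq0 // mul1r.
have [f [fu fv]] := primitive_root v.
case: (ex_minnP fu) => i fi imin; apply: nRv.
suff : R (iota f`_i / v).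
  move=> /(integral_mul (integral_iota (f`_i)^-1)).
  by rewrite mulrA -rmorphM mulVr // rmorph1 mul1r.
apply: (integral_term_of_root v0 fv) => k ki; have [lt_ki|le_ik] := ltnP k i; last first.
  rewrite -mulrA; apply: integral_mul (integral_iota _) _.
  by apply: integral_div_exp => //; rewrite ltn_neqAle eq_sym ki.
have [b ->] : divides pi f`_k.
  apply: (nonunit_divides dvr); apply: contraTN lt_ki => /imin.
  by rewrite -leqNgt.
have -> : iota (pi * b) * v ^+ k / v ^+ i.+1
    = iota b * v ^+ k * (iota pi / v ^+ i.+1) by rewrite rmorphM; ring.
by apply: integral_mul => //; apply: integral_mul (integral_iota _) (integral_exp _ _).
Qed.
End IntegralClosure.

(** Two roots of an irreducible polynomial satisfy the same equations. *)
Lemma conjugate_root (L : fieldType) (M : fieldExtType L) (q h : {poly L}) (a b : M) :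
  irreducible_poly q -> root (map_poly (in_alg M) q) a ->
  root (map_poly (in_alg M) h) a -> root (map_poly (in_alg M) q) b ->
  root (map_poly (in_alg M) h) b.
Proof.
move=> irr qa ha qb; have [co|qh] := irredp_XsubCP irr (dvdp_gcdl q h).
  have /coprimep_root/(_ qa) : coprimep (map_poly (in_alg M) q) (map_poly (in_alg M) h).
    by rewrite coprimep_map -gcdp_eqp1.
  by rewrite (rootP ha) eqxx.
have : q %| h by rewrite -(eqp_dvdl _ qh) dvdp_gcdr.
rewrite -(dvdp_map (in_alg M)) -!dvdp_XsubCl in qb *.
exact: dvdp_trans.
Qed.

Section Henselian.
Variables (A : idomainType) (pi : A).
Hypothesis dvr : complete_dvr pi.
Variables (L : fieldType) (j : {rmorphism {fraction A} -> L}).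
Hypothesis alg : forall x, algebraicOver j x.
Local Notation iota := (j \o @FracField.tofrac A).
Local Notation R := (integralOver iota).

Lemma algebraic_extension (M : fieldExtType L) (x : M) :
  algebraicOver (in_alg M \o j) x.
Proof.
apply/integral_algebraic.
have /polyOver1P[q qE] := minPolyOver 1%AS x.
apply: (integral_root (p := minPoly 1 x)).
- exact: monic_neq0 (monic_minPoly 1 x).
- exact: root_minPoly.
- apply/integral_poly => i; rewrite qE coef_map.
  by apply: integral_rmorph; apply/integral_algebraic.
Qed.

(** The quadratic X^2 - t X + 1 with t = 2 (1 + u) / (1 - u) has the roots
    (1 - w) / (1 + w) and (1 + w) / (1 - w) where w^2 = u.  If u has no square
    root, it is irreducible; its two roots are then inverse to each other and
    conjugate, so that [integral_or_inv] in the extension makes both integral.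
    But t is not integral, 1 + u being a unit and 1 - u a non-unit.  The case
    u = 1 is absent here because 0^-1 = 0. *)
Lemma near_one_square u : (2%:R : L) != 0 -> R 2%:R^-1 -> ~ R (1 - u)^-1 ->
  exists w, w ^+ 2 = u.
Proof.
move=> two0 half nRu; apply: contrapT => nsq.
have u1 : 1 - u != 0.
  by apply/eqP => u1; apply: nRu; rewrite u1 invr0; exact: integral0.
pose t := 2%:R * (1 + u) / (1 - u).
have u2 : 1 + u != 0.
  apply/eqP => u2; apply: nRu; suff -> : 1 - u = 2%:R by [].
  by rewrite -[RHS]subr0 -u2; ring.
have four0 : (4%:R : L) != 0 by rewrite (natrM _ 2 2) mulf_neq0.
have noroot y : ~~ root ('X^2 - t *: 'X + 1) y.
  apply/negP => /rootP; rewrite !hornerE => ty.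
  have ty' : (1 - u) * (y ^+ 2 + 1) = 2%:R * (1 + u) * y.
    have : (y ^+ 2 + 1) = t * y by apply/eqP; rewrite -subr_eq0 -ty; apply/eqP; ring.
    by move=> ->; rewrite /t; field.
  have y1 : 1 + y != 0.
    apply/eqP => /eqP; rewrite addrC addr_eq0 => /eqP yE.
    move: ty'; rewrite yE => /eqP; rewrite -subr_eq0.
    have -> : (1 - u) * ((-1) ^+ 2 + 1) - 2%:R * (1 + u) * -1 = 4%:R by ring.
    by rewrite (negPf four0).
  apply: nsq; exists ((1 - y) / (1 + y)); rewrite expr_div_n.
  apply: (mulIf (_ : (1 + y) ^+ 2 != 0)); first by rewrite expf_neq0.
  rewrite divfK ?expf_neq0 //; apply: (mulfI two0).
  apply/eqP; rewrite -subr_eq0.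
  have -> : 2%:R * (1 - y) ^+ 2 - 2%:R * (u * (1 + y) ^+ 2) =
    2%:R * ((1 - u) * (y ^+ 2 + 1) - 2%:R * (1 + u) * y) by ring.
  by rewrite ty' subrr mulr0.
have szp : size ('X^2 - t *: 'X + 1 : {poly L}) = 3.
  rewrite -addrA size_polyDl ?size_polyXn // (leq_ltn_trans (size_polyD _ _)) //.
  rewrite gtn_max size_polyN size_poly1 andbT (leq_ltn_trans (size_scale_leq _ _)) //.
  by rewrite size_polyX.
have irr : irreducible_poly ('X^2 - t *: 'X + 1 : {poly L}).
  by apply: cubic_irreducible; rewrite // szp.
have [M _ [z rz _]] := irredp_FAdjoin irr.
have zE : z ^+ 2 - t *: z + 1 = 0.
  move/rootP: rz; rewrite rmorphD rmorphB /= map_polyZ map_polyXn map_polyX rmorph1.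
  by rewrite !hornerE mulr_algl.
have z0 : z != 0.
  apply/eqP => z0; move/eqP: zE.
  by rewrite z0 expr0n scaler0 subr0 add0r oner_eq0.
have zV : z^-1 = t%:A - z.
  apply: (mulIf z0); rewrite mulVf // mulrBl mulr_algl -expr2.
  by apply/eqP; rewrite -subr_eq0 -[X in _ == X]zE; apply/eqP; ring.
have rzV : root (map_poly (in_alg M) ('X^2 - t *: 'X + 1)) z^-1.
  apply/rootP; rewrite rmorphD rmorphB /= map_polyZ map_polyXn map_polyX rmorph1.
  rewrite !hornerE mulr_algl; apply: (mulfI (expf_neq0 2 z0)); rewrite mulr0 -zE.
  rewrite -(mulr_algl t z) -(mulr_algl t z^-1); by move: (t%:A) => t'; field.
have Rz : integralOver (in_alg M \o j \o @FracField.tofrac A) z /\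
          integralOver (in_alg M \o j \o @FracField.tofrac A) z^-1.
  have [] := integral_or_inv dvr (@algebraic_extension M) z => -[h mh hz];
    split; exists h => //; rewrite map_poly_comp map_poly_comp in hz *.
  - exact: conjugate_root irr rz hz rzV.
  - exact: conjugate_root irr rzV hz rz.
have Rt : R t.
  have : integralOver (in_alg M \o j \o @FracField.tofrac A) (t%:A : M).
    have -> : t%:A = z + z^-1 by rewrite zV addrC subrK.
    by case: Rz; exact: integral_add.
  case=> h mh; rewrite map_poly_comp map_poly_comp => /rootP.
  rewrite -in_algE horner_map => /eqP; rewrite fmorph_eq0 => ht.
  by exists h; rewrite // map_poly_comp.
have Ru2 : R (1 + u)^-1.
  have [Ra|] := integral_or_inv dvr alg ((1 - u) / (1 + u)).
    have -> : (1 + u)^-1 = 2%:R^-1 * ((1 - u) / (1 + u) + 1).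
      by field; rewrite u2 two0.
    by apply: integral_mul half _; apply: integral_add Ra (integral1 _).
  rewrite invf_div => Rb; case: nRu.
  have -> : (1 - u)^-1 = 2%:R^-1 * ((1 + u) / (1 - u) + 1).
    by field; rewrite u1 two0.
  by apply: integral_mul half _; apply: integral_add Rb (integral1 _).
apply: nRu.
have -> : (1 - u)^-1 = 2%:R^-1 * t * (1 + u)^-1 by rewrite /t; field; rewrite u1 u2 two0.
by apply: integral_mul => //; apply: integral_mul.
Qed.
End Henselian.

(** The properties of a ring of integers R in its field F on which the
    arithmetic below rests.  A nonzero v in R is a non-unit when v^-1 is not in
    R; under this convention [hens_near_one] excludes u = 1, since 0^-1 = 0. *)
Record henselian (F : fieldType) (R : set F) : Prop := Henselian {
  hens1 : R 1;
  hensB : forall x y, R x -> R y -> R (x - y);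
  hensM : forall x y, R x -> R y -> R (x * y);
  hens_or_inv : forall x, R x \/ R x^-1;
  hens_separated : forall v x, v != 0 -> R v -> ~ R v^-1 ->
    (forall n, R (x / v ^+ n)) -> x = 0;
  hens_near_one : forall u, (2%:R : F) != 0 -> R 2%:R^-1 -> ~ R (1 - u)^-1 ->
    exists w, w ^+ 2 = u;
  hens_nonunit : exists v, [/\ v != 0, R v & ~ R v^-1]
}.

Lemma henselian_integral (A : idomainType) (pi : A) (L : fieldType)
    (j : {rmorphism {fraction A} -> L}) :
  complete_dvr pi -> (forall x, algebraicOver j x) ->
  henselian (integralOver (j \o @FracField.tofrac A)).
Proof.
move=> dvr alg; split.
- exact: integral1.
- by move=> x y Rx Ry; exact: (integral_sub Rx Ry).
- by move=> x y Rx Ry; exact: (integral_mul Rx Ry).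
- exact: (integral_or_inv dvr alg).
- exact: (integral_separated dvr alg).
- exact: (near_one_square dvr alg).
- exists (j (FracField.tofrac pi)); have pi0 := cdvr_neq0 dvr; split.
  + by rewrite fmorph_eq0 tofrac_eq0.
  + exact: (integral_iota j pi).
  + move=> /(integral_inv_iota pi0); apply/negP; exact: cdvr_nonunit.
Qed.

(** Used for power series, whose ring of integers is given as k[[t]] itself and
    not as an integral closure. *)
Lemma integral_frac (A : idomainType) (pi : A) (x : {fraction A}) :
  complete_dvr pi ->
  integralOver (@FracField.tofrac A) x <-> exists a, x = FracField.tofrac a.
Proof.
move=> dvr; split=> [|[a ->]]; last exact: integral_id.
have [->|x0] := eqVneq x 0; first by exists 0; rewrite rmorph0.
have [a [b [b0 xE]]] := fracP x.
have a0 : a != 0 by apply: contraNneq x0 => a0; rewrite xE a0 rmorph0 mul0r.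
have [m [u [uu aE]]] := cdvr_factor dvr a0.
have [n [v [vu bE]]] := cdvr_factor dvr b0.
have pi0 := cdvr_neq0 dvr.
have [le_nm _|lt_mn] := leqP n m.
  exists (pi ^+ (m - n) * (u / v)); rewrite xE.
  have -> : a = pi ^+ (m - n) * (u / v) * b.
    by rewrite aE bE mulrACA divrK // -exprD subnK.
  by rewrite rmorphM mulfK // tofrac_eq0.
have bE' : b = pi ^+ (n - m) * (v / u) * a.
  by rewrite aE bE mulrACA divrK // -exprD subnK // ltnW.
have -> : x = (FracField.tofrac (pi ^+ (n - m) * (v / u)))^-1.
  by rewrite xE {1}bE' rmorphM invfM mulrCA divff ?tofrac_eq0 // mulr1.
move=> Rx; have /idP : pi ^+ (n - m) * (v / u) \is a GRing.unit.
  apply: (@integral_inv_iota A _ idfun) Rx.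
  have unit_neq0 (w : A) : w \is a GRing.unit -> w != 0.
    by apply: contraTneq => ->; rewrite unitr0.
  by do !apply: mulf_neq0; rewrite ?expf_neq0 // unit_neq0 ?unitrV.
rewrite unitrM unitrX_pos ?subn_gt0 //.
by rewrite (negPf (cdvr_nonunit dvr)).
Qed.

Lemma integers_henselian (F : local_field) : henselian (@integers F).
Proof.
case: F => [p L|k].
  apply: (henselian_integral (j := in_alg L) (padic_complete_dvr p)) => x.
  have /polyOver1P[q qE] := minPolyOver 1%AS x.
  exists q; last by rewrite -qE root_minPoly.
  by rewrite -(map_poly_eq0 (in_alg L)) -qE monic_neq0 ?monic_minPoly.
have dvr := pseries_complete_dvr k.
suff -> : @integers (LaurentField k) =
    integralOver (idfun \o @FracField.tofrac (pseries k)).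
  apply: (henselian_integral (j := idfun) dvr) => x.
  exists ('X - x%:P); first by rewrite monic_neq0 ?monicXsubC.
  by rewrite map_poly_id // root_XsubC.
by apply/seteqP; split=> x /(integral_frac x dvr).
Qed.

(** * The residue field *)

(** A complete system of representatives of R / P, together with what makes the
    induced operations a field: the carrier of the residue field is the type of
    indices of the representatives. *)
Record residue_system (F : fieldType) (R P : set F) := ResidueSystem {
  rs_card : nat;
  rs_repr : 'I_rs_card -> F;
  rs_class : F -> 'I_rs_card;
  rs_1 : R 1;
  rs_B : forall x y, R x -> R y -> R (x - y);
  rs_M : forall x y, R x -> R y -> R (x * y);
  rs_ideal : is_ideal R P;
  rs_proper : ~ P 1;
  rs_inv : forall x, R x -> ~ P x -> exists2 y, R y & P (y * x - 1);
  rs_repr_int : forall i, R (rs_repr i);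
  rs_classP : forall x, R x -> P (x - rs_repr (rs_class x));
  rs_class_uniq : forall x i, R x -> P (x - rs_repr i) -> rs_class x = i
}.

Section ResidueField.
Variables (F : fieldType) (R P : set F).

Definition residue (D : residue_system R P) := 'I_(rs_card D).

Variable D : residue_system R P.
HB.instance Definition _ := Finite.on (residue D).

Local Notation T := (residue D).
Local Notation cl := (@rs_class _ _ _ D : F -> T).
Local Notation re := (@rs_repr _ _ _ D : T -> F).
Let R1 := rs_1 D.
Let RB := @rs_B _ _ _ D.
Let RM := @rs_M _ _ _ D.
Let R0 : R 0. Proof. by rewrite -(subrr 1); apply: RB. Qed.
Let RN x : R x -> R (- x). Proof. by rewrite -sub0r; apply: RB. Qed.
Let RD x y : R x -> R y -> R (x + y).
Proof. by move=> Rx /RN; rewrite -{2}[y]opprK; apply: RB. Qed.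
Let Rre i : R (re i) := rs_repr_int i.

Lemma res_class_eq x y : R x -> R y -> (cl x = cl y) <-> P (x - y).
Proof.
have [sPR P0 PD PM] := rs_ideal D.
move=> Rx Ry; split=> [e|Pxy].
  have -> : x - y = (x - re (cl x)) + -1 * (y - re (cl y)) by rewrite e; ring.
  by apply: PD; [apply: rs_classP | apply: PM (RN R1) _; apply: rs_classP].
apply: rs_class_uniq => //.
by rewrite -(subrK y x) -addrA; apply: PD => //; apply: rs_classP.
Qed.

Lemma res_reprK i : cl (re i) = i.
Proof.
by apply: rs_class_uniq => //; rewrite subrr; have [] := rs_ideal D.
Qed.

Lemma res_reprP x : R x -> P (re (cl x) - x).
Proof. by move=> Rx; apply/res_class_eq; rewrite ?res_reprK. Qed.

Definition res_add (i j : T) : T := cl (re i + re j).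
Definition res_mul (i j : T) : T := cl (re i * re j).
Definition res_opp (i : T) : T := cl (- re i).

Lemma res_addE x y : R x -> R y -> res_add (cl x) (cl y) = cl (x + y).
Proof.
have [sPR P0 PD PM] := rs_ideal D.
move=> Rx Ry; apply/res_class_eq; try exact: RD.
have -> : re (cl x) + re (cl y) - (x + y) = (re (cl x) - x) + (re (cl y) - y) by ring.
by apply: PD; apply: res_reprP.
Qed.

Lemma res_mulE x y : R x -> R y -> res_mul (cl x) (cl y) = cl (x * y).
Proof.
have [sPR P0 PD PM] := rs_ideal D.
move=> Rx Ry; apply/res_class_eq; try exact: RM.
have -> : re (cl x) * re (cl y) - x * y
    = re (cl y) * (re (cl x) - x) + x * (re (cl y) - y) by ring.
by apply: PD; apply: PM => //; apply: res_reprP.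
Qed.

Fact res_addC : commutative res_add.
Proof. by move=> i j; rewrite /res_add addrC. Qed.
Fact res_addA : associative res_add.
Proof.
move=> i j k; rewrite -[i]res_reprK -[j]res_reprK -[k]res_reprK.
by rewrite !res_addE ?addrA //; apply: RD.
Qed.
Fact res_add0 : left_id (cl 0) res_add.
Proof. by move=> i; rewrite -[i]res_reprK res_addE ?add0r. Qed.
Fact res_addN : left_inverse (cl 0) res_opp res_add.
Proof.
move=> i; rewrite -{2}[i]res_reprK /res_opp res_addE ?addNr //; exact: RN.
Qed.
HB.instance Definition _ := GRing.isZmodule.Build T
  res_addA res_addC res_add0 res_addN.

Fact res_mulC : commutative res_mul.
Proof. by move=> i j; rewrite /res_mul mulrC. Qed.
Fact res_mulA : associative res_mul.
Proof.
move=> i j k; rewrite -[i]res_reprK -[j]res_reprK -[k]res_reprK.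
by rewrite !res_mulE ?mulrA //; apply: RM.
Qed.
Fact res_mul1 : left_id (cl 1) res_mul.
Proof. by move=> i; rewrite -[i]res_reprK res_mulE ?mul1r. Qed.
Fact res_mulDl : left_distributive res_mul res_add.
Proof.
move=> i j k; rewrite -[i]res_reprK -[j]res_reprK -[k]res_reprK.
by rewrite !(res_addE, res_mulE) ?mulrDl //; do ?[apply: RM | apply: RD].
Qed.
Fact res_1neq0 : cl 1 != cl 0.
Proof.
by apply/eqP => /res_class_eq; rewrite subr0 => /(_ R1 R0); apply: rs_proper D.
Qed.
HB.instance Definition _ := GRing.Zmodule_isComNzRing.Build T
  res_mulA res_mulC res_mul1 res_mulDl res_1neq0.

Definition res_inv (i : T) : T := odflt i [pick j | j * i == 1].
Fact res_mulVf i : i != 0 -> res_inv i * i = 1.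
Proof.
move=> i0; rewrite /res_inv; case: pickP => [j /eqP //|/= h].
have [|y Ry Py] := @rs_inv _ _ _ D (re i) (Rre i).
  move=> Pi; case/eqP: i0; rewrite -[i]res_reprK.
  by apply/(res_class_eq (Rre i) R0); rewrite subr0.
move/eqP: (h (cl y)); case.
rewrite -[X in _ * X]res_reprK [LHS]res_mulE //.
by apply/res_class_eq => //; apply: RM.
Qed.
Fact res_inv0 : res_inv 0 = 0.
Proof.
rewrite /res_inv; case: pickP => // j; rewrite mulr0 eq_sym.
by rewrite oner_eq0.
Qed.
HB.instance Definition _ := GRing.ComNzRing_isField.Build T res_mulVf res_inv0.

End ResidueField.

(** * Square classes of units *)

Lemma finField_generator (k : finFieldType) : exists2 g : k,
  (forall n, (g ^+ n == 1) = (#|k|.-1 %| n)%N) & forall x, x != 0 -> exists n, x = g ^+ n.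
Proof.
have /cyclicP[g gE] := field_unit_group_cyclic [set: {unit k}]%G.
exists (val g) => [n|x x0].
  rewrite -FinRing.val_unitX -[1 in LHS]/(val (1%g : {unit k})) (inj_eq val_inj).
  by rewrite -order_dvdn /order -gE card_finField_unit.
have xu : x \is a GRing.unit by rewrite unitfE.
have : FinRing.unit k xu \in <[g]>%g by rewrite -gE inE.
by case/cycleP=> n /(congr1 val) /= ->; exists n; rewrite FinRing.val_unitX.
Qed.

(** Squares are the even powers of a generator. *)
Lemma finField_square_classes (k : finFieldType) (e a : k) :
  e != 0 -> (forall b, e <> b ^+ 2) -> exists b, a = b ^+ 2 \/ a = e * b ^+ 2.
Proof.
move=> e0 ensq; have [g _ gP] := finField_generator k.
have [->|/gP[n ->]] := eqVneq a 0; first by exists 0; left; rewrite expr0n.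
have [m eE] := gP e e0.
have sq i : ~~ odd i -> g ^+ i = (g ^+ i./2) ^+ 2.
  by move=> oi; rewrite -exprM muln2 even_halfK.
have om : odd m by apply: contraT => /sq; rewrite -eE => /ensq.
have [on|en] := boolP (odd n); last by exists (g ^+ n./2); left; exact: sq.
exists (g ^+ (n + m)./2 / e); right.
rewrite expr_div_n -sq ?oddD ?on ?om // exprD -eE; field; exact: e0.
Qed.

(** With #|k| = 4m + 1, the power g^(2m) of a generator has square 1 and is not
    1, so it is -1. *)
Lemma finField_sqrt_neg1 (k : finFieldType) : (#|k| = 1 %[mod 4])%N ->
  exists b : k, b ^+ 2 = -1.
Proof.
have [g gE _] := finField_generator k; have k1 := card_finNzRing_gt1 k => k4.
have [m kE] : exists m, #|k| = (m.*2.*2).+1.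
  by exists (#|k| %/ 4)%N; rewrite -!muln2; move: k4; clear; move: #|k| => c; lia.
exists (g ^+ m); apply/eqP; rewrite -exprM muln2.
have m0 : (0 < m)%N by move: k1; rewrite kE; clear; lia.
have : g ^+ m.*2 == 1 = false.
  rewrite gE kE /=; apply/negP => /dvdn_leq; rewrite double_gt0 => /(_ m0).
  by clear -m0; lia.
have : (g ^+ m.*2) ^+ 2 == 1 by rewrite -exprM muln2 gE kE /= dvdnn.
by rewrite sqrf_eq1 => /orP[->|].
Qed.

(** With #|k| = 4m + 3, b^(#|k| - 1) = 1 would be an odd power of b^2 = -1. *)
Lemma finField_no_sqrt_neg1 (k : finFieldType) (b : k) : (#|k| = 3 %[mod 4])%N ->
  (2%:R : k) != 0 -> b ^+ 2 <> -1.
Proof.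
move=> k4 two0 bE; have [m kE] : exists m, #|k| = (m.*2.*2 + 3)%N.
  by exists (#|k| %/ 4)%N; rewrite -!muln2; move: k4; clear; move: #|k| => c; lia.
have b0 : b != 0.
  by apply/eqP => b0; move/eqP: bE; rewrite b0 expr0n eq_sym oppr_eq0 oner_eq0.
have := expf_card b; rewrite kE.
have -> : (m.*2.*2 + 3 = (2 * (m.*2.+1)).+1)%N by lia.
rewrite exprS exprM bE -signr_odd /= odd_double expr1 => /eqP.
rewrite mulrN1 eq_sym -addr_eq0 -mulr2n -mulr_natr mulf_eq0.
by rewrite (negPf b0) (negPf two0).
Qed.

Definition nonsquare (F : fieldType) (e : F) := forall v, e <> v ^+ 2.

Section Residues.
Variables (F : fieldType) (R P : set F).
Hypothesis hR : henselian R.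
Hypothesis maxP : is_maximal_ideal R P.

Let R1 := hens1 hR.
Let RB := hensB hR.
Let RM := hensM hR.
Lemma henselian0 : R 0. Proof. by rewrite -(subrr 1); apply: RB. Qed.
Let R0 := henselian0.
Lemma henselianN x : R x -> R (- x). Proof. by rewrite -sub0r; apply: RB. Qed.
Let RN := henselianN.
Lemma henselianD x y : R x -> R y -> R (x + y).
Proof. by move=> Rx /RN; rewrite -{2}[y]opprK; apply: RB. Qed.
Let RD := henselianD.

Lemma is_unitM u v : is_unit R u -> is_unit R v -> is_unit R (u * v).
Proof.
case=> Ru u0 Ru' [Rv v0 Rv']; split; [exact: RM | by rewrite mulf_neq0 |].
by rewrite invfM; apply: RM.
Qed.
Lemma is_unitV u : is_unit R u -> is_unit R u^-1.
Proof. by case=> Ru u0 Ru'; split; rewrite ?invr_eq0 ?invrK. Qed.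
Lemma is_unit1 : is_unit R 1.
Proof. by split; rewrite ?oner_eq0 ?invr1. Qed.
Lemma is_unitN u : is_unit R u -> is_unit R (- u).
Proof. by case=> Ru u0 Ru'; split; rewrite ?oppr_eq0 ?invrN //; apply: RN. Qed.
Lemma is_unitX u n : is_unit R u -> is_unit R (u ^+ n).
Proof.
move=> uu; elim: n => [|n IH]; first by rewrite expr0; exact: is_unit1.
by rewrite exprS; apply: is_unitM.
Qed.

(** R is local: if y divides x, a unit x + y = y (x / y + 1) makes y a unit. *)
Lemma nonunitD x y : R x -> R y -> is_unit R (x + y) -> is_unit R x \/ is_unit R y.
Proof.
move=> Rx Ry [Rxy xy0 Rxy'].
have key a b : R a -> R b -> b != 0 -> a + b != 0 -> R (a + b)^-1 ->
    R (a / b) -> is_unit R b.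
  move=> Ra Rb b0 ab0 Rab' Rab; split=> //.
  have -> : b^-1 = (a / b + 1) * (a + b)^-1 by field; rewrite b0 ab0.
  by apply: RM => //; apply: RD.
have [y0|y0] := eqVneq y 0; first by left; rewrite y0 addr0 in Rxy' xy0; split.
have [x0|x0] := eqVneq x 0; first by right; rewrite x0 add0r in Rxy' xy0; split.
have [Rq|Rq] := hens_or_inv hR (x / y); first by right; apply: key Rq.
by left; apply: (key y x) => //; rewrite 1?addrC // -invf_div.
Qed.

(** The non-units form an ideal by [nonunitD], and it contains every proper
    ideal. *)
Lemma maximal_idealP x : P x <-> R x /\ ~ is_unit R x.
Proof.
have [[sPR P0 PD PM] PnR Pmax] := maxP; split=> [Px|[Rx nux]].
  split=> [|[_ x0 Rx']]; first exact: sPR.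
  apply: PnR; apply/seteqP; split=> // y Ry.
  by rewrite -(divfK x0 y); apply: PM => //; apply: RM.
have nu0 : ~ is_unit R 0 by case; rewrite eqxx.
pose J : set F := fun y => R y /\ ~ is_unit R y.
have idJ : is_ideal R J.
  split=> [y []//|//|y z [Ry nuy] [Rz nuz]|r y Rr [Ry nuy]].
    by split=> [|/nonunitD[]//]; apply: RD.
  split=> [|[_ ry0 Rry]]; first exact: RM.
  apply: nuy; move: ry0; rewrite mulf_eq0 negb_or => /andP[r0 y0]; split=> //.
  by rewrite -[y^-1]mul1r -(divff r0) -mulrA -invfM; apply: RM.
have [|JP|JR] := Pmax J idJ.
- move=> y Py; split; first exact: sPR.
  case=> _ y0 Ry'; apply: PnR; apply/seteqP; split=> // z Rz.
  by rewrite -(divfK y0 z); apply: PM => //; apply: RM.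
- by rewrite -JP.
- by have : J 1 by [rewrite JR]; case=> _; case; exact: is_unit1.
Qed.

Lemma unit_or_P x : R x -> is_unit R x \/ P x.
Proof.
by move=> Rx; have [|nu] := pselect (is_unit R x); [left | right; apply/maximal_idealP].
Qed.

Lemma unit_notP x : is_unit R x -> ~ P x.
Proof. by move=> ux /maximal_idealP[]. Qed.

Section Odd.
Variable l : nat.
Hypotheses (charl : quotient_char P l) (oddl : odd l).

(** If 2 and the odd number l were both in P, so would be 1. *)
Lemma two_unit : is_unit R 2%:R.
Proof.
have [[sPR P0 PD PM] _ _] := maxP.
have [//|P2] := @unit_or_P 2%:R (RD R1 R1).
case: (@unit_notP 1 is_unit1).
have -> : 1 = l%:R + - (l./2)%:R * 2%:R :> F.
  by rewrite mulNr -natrM muln2 -{1}(odd_double_half l) oddl natrD addrK.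
have RNat n : R n%:R.
  by elim: n => [|n IH]; [exact: R0 | rewrite mulrS; apply: RD].
by apply: PD; [case: charl | apply: PM => //; apply: RN].
Qed.

Lemma sqrt_near_one u : P (1 - u) -> exists w, w ^+ 2 = u.
Proof.
move=> Pu; have [R2 two0 R2'] := two_unit.
have [->|u1] := eqVneq u 1; first by exists 1; rewrite expr1n.
apply: (hens_near_one hR) => // Ru.
have /maximal_idealP[Ru' []] := Pu; split=> //.
by rewrite subr_eq0 eq_sym.
Qed.

Lemma is_unit_sqrt w u : is_unit R u -> w ^+ 2 = u -> is_unit R w.
Proof.
case=> Ru u0 Ru' wE; have w0 : w != 0.
  by apply: contraNneq u0 => w0; rewrite -wE w0 expr0n.
have [Rw|Rw] := hens_or_inv hR w; split=> //.
- have -> : w^-1 = w * u^-1 by rewrite -wE; field.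
  exact: RM.
- have -> : w = w^-1 * u by rewrite -wE; field.
  exact: RM.
Qed.

(** a / b is close to 1. *)
Lemma sqrt_congruent a b : is_unit R b -> P (a - b) -> exists w, a = b * w ^+ 2.
Proof.
move=> [Rb b0 Rb'] Pab; have [[sPR P0 PD PM] _ _] := maxP.
have [|w wE] := @sqrt_near_one (a / b).
  have -> : 1 - a / b = - b^-1 * (a - b) by field.
  by apply: PM => //; apply: RN.
by exists w; rewrite wE mulrC divfK.
Qed.

Section Residue.
Variable q : nat.
Hypothesis cardq : quotient_card R P q.

Lemma residue_field : exists (k : finFieldType) (phi : F -> k),
  [/\ #|k| = q, phi 1 = 1 /\ forall x y, R x -> R y -> phi (x + y) = phi x + phi y,
      forall x y, R x -> R y -> phi (x * y) = phi x * phi y,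
      forall x, R x -> phi x = 0 <-> P x
    & forall z, exists2 x, R x & phi x = z].
Proof.
have [[sPR P0 PD PM] PnR Pmax] := maxP.
have [r [Rr rP]] := cardq.
have /choice[cl clP] x : exists i, R x -> P (x - r i).
  have [Rx|nRx] := pselect (R x); first by have [i [Pi _]] := rP x Rx; exists i.
  by have [i _] := rP 0 R0; exists i.
have cl_uniq x i : R x -> P (x - r i) -> cl x = i.
  move=> Rx Pi; have [i' [_ u]] := rP x Rx.
  by rewrite -(u i Pi) (u (cl x)) //; apply: clP.
have inv x : R x -> ~ P x -> exists2 y, R y & P (y * x - 1).
  move=> Rx nPx; have [[_ x0 Rx']|//] := unit_or_P Rx.
  by exists x^-1; rewrite // mulVf // subrr.
have proper : ~ P 1 by apply: unit_notP is_unit1.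
have idP : is_ideal R P by [].
pose D := ResidueSystem R1 RB RM idP proper inv Rr clP cl_uniq.
exists (residue D : finFieldType), cl; split=> //.
- by rewrite card_ord.
- by split=> // x y Rx Ry; rewrite -[LHS](res_addE D).
- by move=> x y Rx Ry; rewrite -[LHS](res_mulE D).
- by move=> x Rx; rewrite -[X in P X]subr0; apply: (res_class_eq D).
- by move=> z; exists (r z); [exact: Rr | exact: (res_reprK (D := D))].
Qed.

(** Both the square root needed and the absence of a square root of e pass
    between F and the residue field by [sqrt_congruent]. *)
Lemma unit_square_classes e u : is_unit R e -> nonsquare e -> is_unit R u ->
  exists s, s != 0 /\ (u = s ^+ 2 \/ u = e * s ^+ 2).
Proof.
move=> ue nse uu; have [k [phi [_ [phi1 phiD] phiM phi0 phiS]]] := residue_field.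
have [Re e0 _] := ue; have [Ru u0 _] := uu.
have [[sPR P0 PD PM] PnR Pmax] := maxP.
have phiB x y : R x -> R y -> phi x = phi y -> P (x - y).
  move=> Rx Ry e'; apply/phi0; first exact: RB.
  rewrite -(mulN1r y) phiD ?phiM //; try (apply: RM => //); try exact: RN.
  have -> : phi (-1) = -1.
    apply/eqP; rewrite -addr_eq0 -phi1 -phiD ?addNr //; last exact: RN.
    by apply/eqP/phi0.
  by rewrite mulN1r e' subrr.
have phie : phi e != 0 by apply/eqP => /(phi0 _ Re); apply: unit_notP ue.
have phin b : phi e <> b ^+ 2.
  have [x Rx <-] := phiS b; rewrite expr2 -phiM // => /(phiB _ _ Re (RM Rx Rx)) Pex.
  have [ux|Px] := unit_or_P (RM Rx Rx).
    have [w wE] := sqrt_congruent ux Pex.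
    by apply: (nse (x * w)); rewrite wE; ring.
  by apply: (unit_notP ue); rewrite -(subrK (x * x) e); apply: PD.
have [b] := finField_square_classes (phi u) phie phin.
have [x Rx <-] := phiS b; rewrite expr2 -phiM //.
have sub v : R v -> phi u = phi v -> exists w, w != 0 /\ u = v * w ^+ 2.
  move=> Rv /(phiB _ _ Ru Rv) Puv; have [uv|Pv] := unit_or_P Rv.
    have [w wE] := sqrt_congruent uv Puv; exists w; split=> //.
    by apply: contraNneq u0 => w0; rewrite wE w0 expr0n mulr0.
  by case: (unit_notP uu); rewrite -(subrK v u); apply: PD.
have Rxx := RM Rx Rx.
case=> [/(sub _ Rxx)|]; last rewrite -phiM // => /(sub _ (RM Re Rxx)).
- case=> w [w0 uE]; exists (x * w); split; last by left; rewrite uE; ring.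
  by apply: contraNneq u0 => xw; rewrite uE -expr2 -exprMn xw expr0n.
- case=> w [w0 uE]; exists (x * w); split; last by right; rewrite uE; ring.
  by apply: contraNneq u0 => xw; rewrite uE -expr2 -mulrA -exprMn xw expr0n mulr0.
Qed.

Lemma sqrt_neg1 : (q = 1 %[mod 4])%N -> exists w : F, w ^+ 2 = -1.
Proof.
have [k [phi [<- [phi1 phiD] phiM phi0 phiS]]] := residue_field.
move=> /finField_sqrt_neg1[b bE]; have [x Rx xE] := phiS b.
have uN1 := is_unitN is_unit1.
have [] := sqrt_congruent uN1 (_ : P (x * x - -1)).
  rewrite opprK; apply/phi0; first by apply: RD => //; apply: RM.
  by rewrite phiD ?phiM ?xE -?expr2 ?bE ?phi1 ?addNr //; apply: RM.
move=> w wE; have w0 : w != 0.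
  apply/eqP => w0; move: wE; rewrite w0 expr0n mulr0 => /eqP.
  rewrite mulf_eq0 orbb => /eqP x0; move: bE; rewrite -xE x0.
  have -> : phi 0 = 0 by apply/phi0 => //; have [[]] := maxP.
  by move/eqP; rewrite expr0n eq_sym oppr_eq0 oner_eq0.
exists (x / w); rewrite expr_div_n expr2 wE; field; exact: w0.
Qed.

Lemma neg1_nonsquare : (q = 3 %[mod 4])%N -> nonsquare (-1 : F).
Proof.
have [k [phi [<- [phi1 phiD] phiM phi0 phiS]]] := residue_field.
move=> q3 v /esym vE.
have uv : is_unit R v by apply: is_unit_sqrt vE; apply: is_unitN is_unit1.
have [Rv _ _] := uv; have [R2 _ _] := two_unit.
have phi2 : (2%:R : k) != 0.
  rewrite -[2%:R]/(1 + 1) -phi1 -phiD //; apply/eqP => /(phi0 _ R2).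
  exact: unit_notP two_unit.
apply: (@finField_no_sqrt_neg1 k (phi v) q3 phi2).
rewrite expr2 -phiM // -expr2 vE; apply/eqP.
rewrite -addr_eq0 -phi1 -phiD ?addNr //; last exact: RN.
by apply/eqP/phi0 => //; have [[]] := maxP.
Qed.
End Residue.
End Odd.
End Residues.

(** * Norm groups of quadratic extensions *)

Definition is_norm (F : fieldType) (d c : F) :=
  exists x y, c = x ^+ 2 - d * y ^+ 2.

Section Norms.
Variables (F : fieldType) (d : F).
Lemma is_norm_sqr x : is_norm d (x ^+ 2).
Proof. by exists x, 0; rewrite expr0n mulr0 subr0. Qed.
(** Brahmagupta's identity. *)
Lemma is_normM a b : is_norm d a -> is_norm d b -> is_norm d (a * b).
Proof.
case=> x [y ->] [z [w ->]]; exists (x * z + d * y * w), (x * w + y * z); ring.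
Qed.
Lemma is_normV a : is_norm d a -> is_norm d a^-1.
Proof.
have [->|a0] := eqVneq a 0; first by rewrite invr0.
move=> na; have -> : a^-1 = a * a^-1 ^+ 2 by field.
by apply: is_normM => //; apply: is_norm_sqr.
Qed.
Lemma is_norm_sqrl a x : is_norm d a -> is_norm d (x ^+ 2 * a).
Proof. by move=> na; apply: is_normM => //; apply: is_norm_sqr. Qed.
Lemma is_normX a n : is_norm d a -> is_norm d (a ^+ n).
Proof.
move=> na; elim: n => [|n IH]; last by rewrite exprS; apply: is_normM.
by rewrite expr0 -(expr1n _ 2); exact: is_norm_sqr.
Qed.
End Norms.

Section NormGroups.
Variables (F : fieldType) (R P : set F) (l q : nat).
Hypotheses (hR : henselian R) (maxP : is_maximal_ideal R P).
Hypotheses (charl : quotient_char P l) (oddl : odd l).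
Hypothesis cardq : quotient_card R P q.

Let R1 := hens1 hR.
Let RB := hensB hR.
Let RM := hensM hR.
Let R0 := henselian0 hR.
Let RN := henselianN hR.
Let RD := henselianD hR.
Let PR x : P x -> R x. Proof. by case/(maximal_idealP hR maxP). Qed.
Let PD x y : P x -> P y -> P (x + y).
Proof. by have [[]] := maxP => *; auto. Qed.
Let PM x y : R x -> P y -> P (x * y).
Proof. by have [[]] := maxP => *; auto. Qed.
Let unitP := unit_or_P hR maxP.
Let unotP := unit_notP hR maxP.
Let sqrt1 := sqrt_near_one hR maxP charl oddl.

Lemma ideal_generatorP a : ideal_generator R P a ->
  [/\ a != 0, P a & forall x, P x -> exists2 y, R y & x = a * y].
Proof.
move=> [Ra PE]; have Pa : P a by rewrite PE; exists 1; rewrite ?mul1r.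
have Pdiv x : P x -> exists2 y, R y & x = a * y.
  by rewrite PE => -[y Ry <-]; exists y; rewrite // mulrC.
split=> //; have [v [v0 Rv nRv]] := hens_nonunit hR.
have /Pdiv[y _ vE] : P v by apply/(maximal_idealP hR maxP); split=> // -[].
by apply: contraNneq v0 => a0; rewrite vE a0 mul0r.
Qed.

Section Uniformizer.
Variable a : F.
Hypothesis genP : ideal_generator R P a.

(** The power of a is found by [hens_separated], which excludes that y is
    divisible by all powers of a. *)
Lemma unit_factor x : x != 0 ->
  exists n u, is_unit R u /\ (x = a ^+ n * u \/ x = u / a ^+ n).
Proof.
have [a0 Pa Pdiv] := ideal_generatorP genP.
have key y : y != 0 -> R y -> exists n u, is_unit R u /\ y = a ^+ n * u.
  move=> y0 Ry.
  have [n0 hn0] : exists n, ~~ `[< R (y / a ^+ n) >].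
    apply: contrapT => /forallNP h; case/eqP: y0.
    have [Ra nua] := (maximal_idealP hR maxP a).1 Pa.
    apply: (hens_separated hR a0 Ra) => [Ra'|n]; first by apply: nua.
    by apply/asboolP/negPn/negP; apply: h.
  have ex : exists n, ~~ `[< R (y / a ^+ n) >] by exists n0.
  case: (ex_minnP ex) => -[|n] /asboolP nR nmin.
    by rewrite expr0 divr1 in nR.
  have Ru : R (y / a ^+ n).
    by apply/asboolP/negPn/negP => /nmin; rewrite ltnn.
  exists n, (y / a ^+ n); split; last by rewrite mulrC divfK ?expf_neq0.
  have [//|/Pdiv[z Rz zE]] := unitP Ru.
  case: nR; rewrite exprS invfM mulrCA zE mulrA mulVf // mul1r.
  exact: Rz.
move=> x0; have [Rx|Rx] := hens_or_inv hR x.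
  by have [n [u [uu ->]]] := key x x0 Rx; exists n, u; split=> //; left.
have [|n [u [uu xE]]] := key x^-1 _ Rx; first by rewrite invr_eq0.
exists n, u^-1; split; [exact: is_unitV | right].
by rewrite -[x]invrK xE invfM mulrC.
Qed.

(** The valuation of a is 1, an odd number. *)
Lemma uniformizer_parity x w : is_unit R w -> a <> x ^+ 2 * w.
Proof.
have [a0 Pa Pdiv] := ideal_generatorP genP.
have nua := (maximal_idealP hR maxP a).1 Pa.
move=> uw aE; have [Rw w0 Rw'] := uw.
have x0 : x != 0 by apply: contraNneq a0 => x0; rewrite aE x0 expr0n mul0r.
have [Rx|Rx] := hens_or_inv hR x.
  have [ux|/Pdiv[y Ry xE]] := unitP Rx.
    by apply: nua.2; rewrite aE; apply: is_unitM => //; apply: is_unitX.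
  have y0 : y != 0 by apply: contraNneq x0 => y0; rewrite xE y0 mulr0.
  apply: nua.2; split=> //; first exact: nua.1.
  have -> : a^-1 = y ^+ 2 * w.
    apply: (mulfI a0); rewrite divff //; apply: (mulfI a0).
    by rewrite mulr1 {1}aE xE; ring.
  by apply: RM => //; rewrite expr2; apply: RM.
apply: nua.2; split=> //; first exact: nua.1.
rewrite aE invfM -exprVn; apply: RM => //; rewrite expr2; exact: RM.
Qed.

Lemma uniformizerM u : is_unit R u -> ideal_generator R P (u * a).
Proof.
have [a0 Pa Pdiv] := ideal_generatorP genP.
case=> Ru u0 Ru'; split; first exact/PR/PM.
apply/seteqP; split=> x => [/Pdiv[y Ry ->]|[y Ry <-]].
  exists (y / u); first exact: RM.
  by rewrite mulrA divfK // mulrC.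
by apply: PM => //; apply: PM.
Qed.
End Uniformizer.

Lemma nonsquare_neq0 (e : F) : nonsquare e -> e != 0.
Proof. by move=> ne; apply/eqP => e0; apply: (ne 0); rewrite e0 expr0n. Qed.

Section Unramified.
Variables (a e : F).
Hypotheses (genP : ideal_generator R P a) (ue : is_unit R e) (ne : nonsquare e).
Let e0 : e != 0 := nonsquare_neq0 ne.

(** Otherwise e would be close to a square, hence a square. *)
Lemma nonsquare_residue z : R z -> is_unit R (z ^+ 2 - e).
Proof.
move=> Rz; have [Re _ Re'] := ue.
have [//|Pz] := @unitP (z ^+ 2 - e) (RB (RM Rz Rz) Re).
have [|w wE] := @sqrt1 (z ^+ 2 / e).
  have -> : 1 - z ^+ 2 / e = - e^-1 * (z ^+ 2 - e) by field.
  by apply: PM => //; apply: RN.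
have z0 : z ^+ 2 != 0.
  apply/eqP => z0; apply: (unotP ue); have -> : e = -1 * (z ^+ 2 - e) by rewrite z0; ring.
  by apply: PM => //; apply: RN.
case: (ne (v := z / w)); rewrite expr_div_n wE; field; by rewrite e0 -sqrf_eq0.
Qed.

Lemma nonsquare_residueV z : R z -> is_unit R (1 - e * z ^+ 2).
Proof.
move=> Rz; have [Re _ Re'] := ue.
have [->|z0] := eqVneq z 0; first by rewrite expr0n mulr0 subr0; exact: is_unit1.
have [//|/sqrt1[w wE]] := @unitP (1 - e * z ^+ 2) (RB R1 (RM Re (RM Rz Rz))).
by case: (ne (v := w / z)); rewrite expr_div_n wE mulfK // expf_neq0.
Qed.

(** In x^2 - e y^2, factor out the square of whichever of x and y divides the
    other: the cofactor is a unit, so the valuation is even. *)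
Lemma unramified_uniformizer_not_norm : ~ is_norm e a.
Proof.
case=> x [y aE]; have [y0|y0] := eqVneq y 0.
  apply: (uniformizer_parity genP (is_unit1 hR) (x := x)).
  by rewrite aE y0 expr0n mulr0 subr0 mulr1.
have [Rz|Rz] := hens_or_inv hR (x / y).
  apply: (uniformizer_parity genP (nonsquare_residue Rz) (x := y)).
  by rewrite aE; field.
have [x0|x0] := eqVneq x 0.
  apply: (uniformizer_parity genP (is_unitN hR ue) (x := y)).
  by rewrite aE x0; ring.
apply: (uniformizer_parity genP (nonsquare_residueV Rz) (x := x)).
by rewrite aE; field; rewrite x0 y0.
Qed.

(** Suppose not.  For x in R, the norm x^2 - e is a unit and not e times a
    square, so it is a square.  Starting from 0, every - n e is therefore
    congruent to a square modulo P; for n = l - 1 this is e itself. *)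
Lemma nonsquare_is_norm : is_norm e e.
Proof.
apply: contrapT => nne; have [Re _ Re'] := ue.
have sq n : exists2 x, R x & P (x ^+ 2 + n%:R * e).
  elim: n => [|n [x Rx Px]].
    by exists 0; rewrite // expr0n mul0r addr0; have [[]] := maxP.
  have uc := nonsquare_residue Rx; have [Rc _ _] := uc.
  have [s [s0 [sE|sE]]] := unit_square_classes hR maxP charl oddl cardq ue ne uc.
    have us : is_unit R s by apply: (is_unit_sqrt hR uc).
    exists s; first by case: us.
    by have -> : s ^+ 2 + n.+1%:R * e = x ^+ 2 + n%:R * e by rewrite -sE mulrS; ring.
  have eE : e = (x ^+ 2 - e * 1 ^+ 2) * s^-1 ^+ 2.
    by rewrite expr1n mulr1 sE; field.
  case: nne; rewrite [X in is_norm _ X]eE.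
  by apply: is_normM (is_norm_sqr _ _); exists x, 1.
have [x Rx Px] := sq l.-1.
apply: (unotP (nonsquare_residue Rx)).
have -> : x ^+ 2 - e = (x ^+ 2 + l.-1%:R * e) + - e * l%:R.
  by rewrite -{2}(prednK (odd_gt0 oddl)) mulrS; ring.
by apply: PD => //; apply: PM; [exact: RN | case: charl].
Qed.

Lemma unramified_unit_norm u : is_unit R u -> is_norm e u.
Proof.
move=> uu.
have [s [s0 [->|->]]] := unit_square_classes hR maxP charl oddl cardq ue ne uu.
  exact: is_norm_sqr.
by apply: is_normM (is_norm_sqr _ _); exact: nonsquare_is_norm.
Qed.

(** Units and even powers of a are norms. *)
Lemma unramified_norm_index c : c != 0 -> is_norm e c \/ is_norm e (c / a).
Proof.
have [a0 _ _] := ideal_generatorP genP.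
move=> c0; have [n [u [uu cE]]] := unit_factor genP c0.
have nu := unramified_unit_norm uu; have [Ru u0 _] := uu.
have an m : ~~ odd m -> a ^+ m = (a ^+ m./2) ^+ 2.
  by move=> om; rewrite -exprM muln2 even_halfK.
have [on|en] := boolP (odd n); [right | left]; case: cE => ->.
- case: n on => // n on.
  have -> : a ^+ n.+1 * u / a = a ^+ n * u by rewrite exprS; field.
  by rewrite an //; apply: is_norm_sqrl.
- have -> : u / a ^+ n / a = u * (a ^+ n.+1)^-1.
    by rewrite exprS; field; rewrite a0 expf_neq0.
  apply: is_normM => //; apply: is_normV.
  by rewrite (an n.+1) /= ?on //; apply: is_norm_sqr.
- by rewrite an //; apply: is_norm_sqrl.
- by apply: is_normM => //; apply: is_normV; rewrite an //; apply: is_norm_sqr.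
Qed.
End Unramified.

Section Ramified.
Variables (a e : F).
Hypotheses (genP : ideal_generator R P a) (ue : is_unit R e) (ne : nonsquare e).
Let e0 : e != 0 := nonsquare_neq0 ne.

Lemma sqrt_one_sub_uniformizer z : R z -> exists w, w ^+ 2 = 1 - a * z ^+ 2.
Proof.
have [a0 Pa _] := ideal_generatorP genP.
move=> Rz; apply: sqrt1; rewrite opprB addrCA subrr addr0 mulrC.
by apply: PM => //; apply: RM.
Qed.

(** In e = x^2 - a y^2 the valuations of the two terms have different parity,
    so x^2 dominates and e is x^2 times an element close to 1, a square. *)
Lemma ramified_nonsquare_not_norm : ~ is_norm a e.
Proof.
have [a0 Pa Pdiv] := ideal_generatorP genP.
case=> x [y eE]; have [y0|y0] := eqVneq y 0.
  by apply: (ne (v := x)); rewrite eE y0 expr0n mulr0 subr0.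
have inv z : R z -> y = x * z -> False.
  move=> Rz yE; have [w wE] := sqrt_one_sub_uniformizer Rz.
  by apply: (ne (v := x * w)); rewrite exprMn wE eE yE; ring.
have [Rz|Rz] := hens_or_inv hR (x / y); last first.
  apply: (inv _ Rz); have [x0|x0] := eqVneq x 0; last by field; rewrite x0 y0.
  case: (uniformizer_parity genP (is_unitN hR ue) (x := y^-1)).
  by rewrite eE x0; field.
have [[_ z0 Rz']|/Pdiv[z Rz0 zE]] := unitP Rz.
  apply: (inv _ Rz'); move: z0; rewrite mulf_eq0 negb_or => /andP[x0 _].
  by field; rewrite x0 y0.
have [w wE] := sqrt_one_sub_uniformizer Rz0.
have uw : is_unit R w.
  apply: (is_unit_sqrt hR _ wE).
  have [//|Pw] := @unitP (1 - a * z ^+ 2) (RB R1 (RM (PR Pa) (RM Rz0 Rz0))).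
  case: (unotP (is_unit1 hR)); rewrite -(subrK (a * z ^+ 2) 1); apply: PD => //.
  by rewrite mulrC; apply: PM => //; apply: RM.
have [_ w0 _] := uw.
apply: (uniformizer_parity genP (x := (y * w)^-1) (is_unitN hR ue)).
have -> : - e = (y * w) ^+ 2 * a.
  by rewrite exprMn wE eE -[x](divfK y0) zE; ring.
by field; rewrite y0 w0.
Qed.

(** The uniformizer - a is the norm of the square root of a, so only the unit
    part matters. *)
Lemma ramified_norm_index c : c != 0 -> is_norm a c \/ is_norm a (c / e).
Proof.
have [a0 _ _] := ideal_generatorP genP.
have := uniformizerM genP (is_unitN hR (is_unit1 hR)); rewrite mulN1r => genN.
have na : is_norm a (- a) by exists 0, 1; ring.
move=> c0; have [n [u [uu cE]]] := unit_factor genN c0.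
have [s [s0 us]] := unit_square_classes hR maxP charl oddl cardq ue ne uu.
have [b nb ->] : exists2 b, is_norm a b & c = b * u.
  case: cE => ->; first by exists ((- a) ^+ n) => //; apply: is_normX.
  by exists ((- a) ^+ n)^-1; [apply/is_normV/is_normX | rewrite mulrC].
case: us => ->; [left | right].
  by apply: is_normM => //; apply: is_norm_sqr.
have -> : b * (e * s ^+ 2) / e = b * s ^+ 2 by field.
by apply: is_normM => //; apply: is_norm_sqr.
Qed.
End Ramified.
End NormGroups.

(** * Isomorphisms between quaternion algebras *)

Lemma alg_isomorphic_refl (F : fieldType) (A : unital_algebra F) : alg_isomorphic A A.
Proof. by exists id; split=> //; exists id. Qed.

Lemma alg_isomorphic_sym (F : fieldType) (A B : unital_algebra F) :
  alg_isomorphic A B -> alg_isomorphic B A.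
Proof.
case=> f [fL [g fK gK] fM]; exists g; split.
- by move=> c x y; rewrite -{1}[x]gK -{1}[y]gK -fL fK.
- by exists f.
- by move=> x y; rewrite -{1}[x]gK -{1}[y]gK -fM fK.
Qed.

Lemma alg_isomorphic_trans (F : fieldType) (A B C : unital_algebra F) :
  alg_isomorphic A B -> alg_isomorphic B C -> alg_isomorphic A C.
Proof.
case=> f [fL fb fM] [g [gL gb gM]]; exists (g \o f); split.
- by move=> c x y; rewrite /= fL gL.
- exact: bij_comp.
- by move=> x y; rewrite /= fM gM.
Qed.

Lemma left_nucleus_iso (F : fieldType) (A B : unital_algebra F) (f : A -> B) x :
  bijective f -> (forall x y, f (alg_mul x y) = alg_mul (f x) (f y)) ->
  left_nucleus A x <-> left_nucleus B (f x).
Proof.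
case=> g fK gK fM; split=> h y z.
  by rewrite -[y]gK -[z]gK -!fM h.
by apply: (can_inj fK); rewrite !fM h.
Qed.

(** An F-algebra isomorphism between quadratic extensions, given as a bare
    function because it is extracted from a map between nonassociative
    algebras. *)
Record field_iso (F : fieldType) (K K' : fieldExtType F) (h : K -> K') : Prop :=
  FieldIso {
    fiL : linear h; fi_bij : bijective h; fiM : forall x y, h (x * y) = h x * h y }.

Section FieldIso.
Variables (F : fieldType) (K K' : fieldExtType F) (h : K -> K').
Hypothesis hi : field_iso h.
Lemma fi0 : h 0 = 0.
Proof. by have := fiL hi (-1) 0 0; rewrite !scaleN1r !addNr. Qed.
Lemma fiD x y : h (x + y) = h x + h y.
Proof. by have := fiL hi 1 x y; rewrite !scale1r. Qed.
Lemma fiZ c x : h (c *: x) = c *: h x.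
Proof. by have := fiL hi c x 0; rewrite fi0 !addr0. Qed.
Lemma fi_eq0 x : (h x == 0) = (x == 0).
Proof. by rewrite -fi0 (inj_eq (bij_inj (fi_bij hi))). Qed.
Lemma fi1 : h 1 = 1.
Proof.
have h1 : h 1 != 0 by rewrite fi_eq0 oner_eq0.
by apply: (mulfI h1); rewrite -(fiM hi) !mulr1.
Qed.
Lemma fiA c : h c%:A = c%:A.
Proof. by rewrite fiZ fi1. Qed.
End FieldIso.

Section QuaternionIso.
Variables (F : fieldType) (K K' : fieldExtType F).
Variables (s : {lrmorphism K -> K}) (s' : {lrmorphism K' -> K'}).
Variables (a : K) (b : K').

Lemma quaternion_iso (h : K -> K') (v : K') :
  field_iso h -> (forall x, h (s x) = s' (h x)) -> v != 0 ->
  h a = v * s' v * b ->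
  alg_isomorphic (quaternion_algebra s a) (quaternion_algebra s' b).
Proof.
move=> hi hs v0 hab; have [g hK gK] := fi_bij hi.
exists (fun x => (h x.1, h x.2 * v)); split.
- move=> c [x1 x2] [y1 y2] /=; congr pair; first exact: (fiL hi).
  by rewrite (fiL hi) mulrDl -scalerAl.
- exists (fun y => (g y.1, g (y.2 / v))) => [[x1 x2]|[y1 y2]] /=.
    by rewrite mulfK // !hK.
  by rewrite !gK divfK.
- case=> x1 x2 [y1 y2]; congr pair => /=.
    by rewrite (fiD hi) !(fiM hi) hab hs rmorphM /=; ring.
  by rewrite (fiD hi) !(fiM hi) hs; ring.
Qed.
End QuaternionIso.

Section Quadratic.
Variables (F : fieldType) (K : fieldExtType F) (s : {lrmorphism K -> K}).
Hypothesis gal : is_quadratic_galois s.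

(** The fixed space of s lies strictly between 0 and the two-dimensional K. *)
Lemma galois_fixed x : (s x == x) = (x \in 1%VS).
Proof.
apply/idP/idP => [sx|/vlineP[c ->]]; last by rewrite linearZ rmorph1.
pose V := fixedSpace (linfun s).
have memV y : (y \in V) = (s y == y).
  by apply/fixedSpaceP/eqP; rewrite lfunE.
have [dimK [x0 sx0]] := gal.
have V1 : (1 <= V)%VS by rewrite [(1 <= V)%VS]memV rmorph1.
have : (\dim V < 2)%N.
  rewrite -dimK ltn_neqAle dimvS ?subvf // andbT; apply/negP => e.
  apply: sx0; apply/eqP; rewrite -memV.
  have /eqP -> : V == fullv by rewrite -(dimv_leqif_eq (subvf V)).
  exact: memvf.
rewrite ltnS => dV; have /eqP-> : (1 == V)%VS by rewrite eqEdim V1 dimv1.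
by rewrite memV.
Qed.

(** For x = k + l t, associativity of (x, t, t) gives l a = l (s a), and s a
    differs from a. *)
Lemma left_nucleus_quaternion a x : a \notin 1%VS ->
  left_nucleus (quaternion_algebra s a) x <-> x.2 = 0.
Proof.
rewrite -galois_fixed => sa; case: x => k l /=; split=> [nuc|->].
  have := congr1 snd (nuc (0, 1) (0, 1)) => /=.
  rewrite !(rmorph0, rmorph1, mulr0, mul0r, mulr1, mul1r, add0r, addr0) => /eqP.
  rewrite eq_sym -subr_eq0 -mulrBr mulf_eq0 subr_eq0 (negPf sa) orbF.
  by move/eqP.
move=> [y1 y2] [z1 z2]; rewrite /= /quat_mul /=.
by congr pair; rewrite /= ?mul0r ?addr0; ring.
Qed.
End Quadratic.

Section IsoConverse.
Variables (F : fieldType) (K K' : fieldExtType F).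
Variables (s : {lrmorphism K -> K}) (s' : {lrmorphism K' -> K'}).
Hypotheses (gal : is_quadratic_galois s) (gal' : is_quadratic_galois s').
Variables (a : K) (b : K').
Hypotheses (aF : a \notin 1%VS) (bF : b \notin 1%VS).

Lemma nucleus_field_iso (f : K -> quaternion_algebra s' b) :
  linear f -> injective f -> (forall x y, f (x * y) = alg_mul (f x) (f y)) ->
  range f = left_nucleus (quaternion_algebra s' b) ->
  exists2 h : K -> K', field_iso h & forall x, f x = (h x, 0).
Proof.
move=> fL finj fM fran; pose h x := (f x).1.
have fE x : f x = (h x, 0).
  have : left_nucleus (quaternion_algebra s' b) (f x) by rewrite -fran; exists x.
  by move/(left_nucleus_quaternion gal' _ bF); rewrite /h; case: (f x) => y z /= ->.
exists h => //; split.
- by move=> c x y; rewrite /h fL.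
- have sur y : exists x, h x = y.
    have : left_nucleus (quaternion_algebra s' b) (y, 0).
      exact/(left_nucleus_quaternion gal' _ bF).
    by rewrite -fran => -[x _ xE]; exists x; rewrite /h xE.
  have [g gP] := choice sur; exists g => // x.
  by apply: finj; rewrite !fE gP.
- by move=> x y; rewrite /h fM !fE /= mul0r mul0r addr0.
Qed.

(** Let f be the isomorphism and f t = u + v t.  It maps the left nucleus K to K'
    by some h.  Applying f to t k = (s k) t gives u h(k) = u h(s k), hence u = 0,
    and h o s = s' o h; applying it to t t = a gives the last equation. *)
Lemma quaternion_iso_inv :
  alg_isomorphic (quaternion_algebra s a) (quaternion_algebra s' b) ->
  exists (h : K -> K') (v : K'), [/\ field_iso h, forall x, h (s x) = s' (h x),
    v != 0 & h a = v * s' v * b].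
Proof.
case=> f [fL fb fM]; pose i (x : K) : quaternion_algebra s a := (x, 0).
have [||||h hi hE] := @nucleus_field_iso (f \o i).
- move=> c x y; rewrite /= -fL; congr f; rewrite /i.
  by rewrite -[RHS]/(c *: x + y, c *: 0 + 0) scaler0 addr0.
- by move=> x y /(bij_inj fb) [].
- move=> x y; rewrite -[RHS]fM; congr f.
  rewrite -[RHS]/(quat_mul s a (i x) (i y)) /quat_mul /=.
  by rewrite /i !(rmorph0, mulr0, mul0r, addr0).
- apply/seteqP; split=> [y [x _ <-]|y].
    by apply/(left_nucleus_iso _ fb fM)/(left_nucleus_quaternion gal _ aF).
  have [g fK gK] := fb; rewrite -[y]gK => /(left_nucleus_iso _ fb fM).
  move=> /(left_nucleus_quaternion gal _ aF).
  by case: (g y) => k l /= ->; exists k.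
rewrite /= in hE.
pose t : quaternion_algebra s a := (0, 1).
case ft : (f t) => [u v].
have tk k : alg_mul t (i k) = alg_mul (i (s k)) t.
  rewrite /= /quat_mul /=.
  by rewrite !(rmorph0, rmorph1, mulr0, mul0r, mulr1, mul1r, addr0, add0r).
have tk' k : (u * h k, v * s' (h k)) = (h (s k) * u, h (s k) * v).
  have := congr1 f (tk k); rewrite !fM ft !hE /= /quat_mul /=.
  by rewrite !(rmorph0, mulr0, mul0r, addr0, add0r).
have u0 : u = 0.
  have [_ [k sk]] := gal; have [/eqP] := tk' k.
  rewrite mulrC -subr_eq0 -mulrBl mulf_eq0 => /orP[|/eqP //].
  rewrite subr_eq0 (inj_eq (bij_inj (fi_bij hi))) eq_sym => /eqP.
  by [].
have v0 : v != 0.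
  apply/eqP => v0; have : f t = f (i 0) by rewrite ft hE u0 v0 (fi0 hi).
  by move/(bij_inj fb) => [] /eqP; rewrite oner_eq0.
exists h, v; split=> // [k|].
  by have [_] := tk' k; rewrite mulrC => /(mulIf v0).
have tt : alg_mul t t = i a.
  by rewrite /= /quat_mul /= rmorph0 rmorph1 !(mulr0, mul0r, mulr1, mul1r, addr0, add0r).
have := congr1 f tt; rewrite fM ft hE u0 /= /quat_mul /= => -[<- _].
by rewrite mul0r add0r.
Qed.
End IsoConverse.

(** * Classification in coordinates *)

Section Coordinates.
Variables (F : fieldType) (K : fieldExtType F) (s : {lrmorphism K -> K}).
Hypothesis gal : is_quadratic_galois s.
Variables (d : F) (r : K).
Hypothesis rd : is_adjoin_sqrt d r.

Lemma sqrt_notin_base : r \notin 1%VS.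
Proof.
apply/negP => /(@Fadjoin_idP _ _ 1%AS) e; have [dimK _] := gal.
by move: dimK; rewrite -rd.2 e dimv1.
Qed.

Lemma conj_sqrt : s r = - r.
Proof.
have /eqP : s r ^+ 2 = r ^+ 2 by rewrite -rmorphXn rd.1 /= linearZ /= rmorph1.
rewrite eqf_sqr (galois_fixed gal) (negPf sqrt_notin_base) /=.
by move/eqP.
Qed.

Lemma coordinates a : exists u v, a = u%:A + v *: r.
Proof.
have /memv_addP[x /vlineP[u ->] [y /vlineP[v ->] ->]] : a \in (1 + <[r]>)%VS.
  suff /eqP -> : (1 + <[r]> == fullv)%VS by exact: memvf.
  have : (\dim (1%VS : {vspace K}) < \dim (1 + <[r]>)%VS)%N; last first.
    by rewrite eqEdim subvf dimv1; have [-> _] := gal.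
  rewrite ltn_neqAle dimvS ?addvSl // andbT.
  apply/negP; rewrite (dimv_leqif_eq (addvSl _ _)) => /eqP e.
  by case/negP: sqrt_notin_base; rewrite e (subvP (addvSr _ _)) ?memv_line.
by exists u, v.
Qed.

Lemma coord_in_base u v : (u%:A + v *: r \in 1%VS) = (v == 0).
Proof.
rewrite rpredDl; last by rewrite memvZ ?memv_line.
apply/idP/eqP => [vr|->]; last by rewrite scale0r mem0v.
apply/eqP; apply: contraTT sqrt_notin_base => v0; rewrite negbK.
by rewrite -[r](scalerK v0) memvZ.
Qed.

Lemma coord_inj u v u' v' : u%:A + v *: r = u'%:A + v' *: r -> u = u' /\ v = v'.
Proof.
move=> e; have e0 : (u - u')%:A + (v - v') *: r = 0.
  by rewrite !scalerBl addrACA e -opprD subrr.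
have : v - v' == 0 by rewrite -(coord_in_base (u - u')) e0 mem0v.
rewrite subr_eq0 => /eqP vv; split=> //; move/eqP: e0.
rewrite vv subrr scale0r addr0 scaler_eq0 oner_eq0 orbF subr_eq0.
by move/eqP.
Qed.

Lemma conj_coord u v : s (u%:A + v *: r) = u%:A - v *: r.
Proof. by rewrite rmorphD /= !linearZ /= rmorph1 conj_sqrt scalerN. Qed.

Lemma norm_coord x y :
  (x%:A + y *: r) * s (x%:A + y *: r) = (x ^+ 2 - d * y ^+ 2)%:A.
Proof.
rewrite conj_coord mulrC -subr_sqr !exprZn rd.1 expr1n scalerA.
by rewrite scalerBl mulrC.
Qed.

(** Isomorphism of the algebras of u + v r and u' + v' r, by
    [quaternion_iso_coord]: the sign of v accounts for the two automorphisms of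
    K/F, the factor n for the norms. *)
Definition coord_equiv (u v u' v' : F) := exists n,
  [/\ n != 0, is_norm d n, u = n * u' & v = n * v' \/ v = - (n * v')].

Lemma quaternion_iso_coord u v u' v' : v != 0 -> v' != 0 ->
  alg_isomorphic (quaternion_algebra s (u%:A + v *: r))
                 (quaternion_algebra s (u'%:A + v' *: r)) <->
  coord_equiv u v u' v'.
Proof.
move=> v0 v'0; split.
  case/(quaternion_iso_inv gal gal _ _); rewrite ?coord_in_base // => h [c [hi hs c0]].
  have [x [y cE]] := coordinates c; rewrite cE norm_coord.
  rewrite (fiD hi) (fiA hi) (fiZ hi) mulr_algl scalerDr !scalerA => ha.
  pose n := x ^+ 2 - d * y ^+ 2; exists n.
  have n0 : n != 0.
    have : c * s c != 0 by rewrite mulf_neq0 ?fmorph_eq0.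
    by rewrite cE norm_coord; apply: contraNneq => n0; rewrite -/n n0 scale0r.
  have : h r ^+ 2 == r ^+ 2 by rewrite expr2 -(fiM hi) -expr2 rd.1 (fiA hi).
  rewrite eqf_sqr => /orP[] /eqP hr; move: ha; rewrite hr.
    by case/coord_inj => -> ->; split=> //; [exists x, y | left].
  rewrite scalerN -scaleNr => /coord_inj[-> e]; split=> //; first by exists x, y.
  by right; rewrite -e opprK.
case=> n [n0 [x [y nE]] uE vE]; pose c := x%:A + y *: r.
have Nc : c * s c = n%:A by rewrite norm_coord -nE.
have c0 : c != 0.
  apply: contraNneq n0 => c0; move/eqP: Nc.
  by rewrite c0 mul0r eq_sym scaler_eq0 oner_eq0 orbF.
have idi : field_iso (@id K) by split=> //; exists id.
have ss z : s (s z) = z.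
  have [p [t ->]] := coordinates z.
  by rewrite conj_coord -scaleNr conj_coord scaleNr opprK.
have si : field_iso s.
  by split; [exact: linearP | exists s | exact: rmorphM].
have mulc p t : n%:A * (p%:A + t *: r) = (n * p)%:A + (n * t) *: r.
  by rewrite mulr_algl scalerDr !scalerA.
case: vE => vE; [apply: (quaternion_iso idi _ c0) | apply: (quaternion_iso si _ c0)] => //.
  by rewrite Nc mulc uE vE.
by rewrite Nc mulc uE vE conj_coord scaleNr opprK.
Qed.

(** A is built from some K', s' and a', where K' is identified with K through
    the left nucleus.  The automorphism s' corresponds to s because it is not
    the identity and can only change the sign of the square root. *)
Lemma quaternion_of_nucleus (A : unital_algebra F) :
  is_nonassoc_quaternion A -> has_left_nucleus A K ->
  exists2 a, a \notin 1%VS & alg_isomorphic A (quaternion_algebra s a).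
Proof.
case=> K' [s' [a' [gal' a'F [phi [phiL phib phiM]]]]] [f [fL finj fM fran]].
have [||||h hi hE] := @nucleus_field_iso F K K' s' gal' a' a'F (phi \o f).
- by move=> c x y; rewrite /= fL phiL.
- exact: inj_comp (bij_inj phib) finj.
- by move=> x y; rewrite /= fM phiM.
- apply/seteqP; split=> [y [x _ <-]|y].
    by apply/(left_nucleus_iso _ phib phiM); rewrite -fran; exists x.
  have [g phiK gK] := phib; rewrite -[y]gK => /(left_nucleus_iso _ phib phiM).
  by rewrite -fran => -[x _ <-]; exists x.
have [g hK gK] := fi_bij hi.
have hrd : h r ^+ 2 = d%:A by rewrite expr2 -(fiM hi) -expr2 rd.1 (fiA hi).
have s'hr : s' (h r) = - h r.
  have /eqP : s' (h r) ^+ 2 = h r ^+ 2 by rewrite -rmorphXn hrd /= linearZ /= rmorph1.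
  rewrite eqf_sqr => /orP[/eqP e|/eqP //].
  have [_ [x []]] := gal'; rewrite -[x]gK; have [u [v ->]] := coordinates (g x).
  by rewrite (fiD hi) (fiA hi) (fiZ hi) rmorphD /= !linearZ /= rmorph1 e.
have hs x : h (s x) = s' (h x).
  have [u [v ->]] := coordinates x.
  rewrite conj_coord -scaleNr !(fiD hi) !(fiA hi) !(fiZ hi) rmorphD /= !linearZ /=.
  by rewrite rmorph1 s'hr scaleNr scalerN.
exists (g a').
  apply: contra a'F => /vlineP[c cE]; rewrite -[a']gK cE (fiA hi).
  by rewrite memvZ ?memv_line.
apply: (alg_isomorphic_trans (B := quaternion_algebra s' a')).
  by exists phi.
apply/alg_isomorphic_sym/(quaternion_iso hi hs (oner_neq0 K')).
by rewrite rmorph1 !mul1r gK.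
Qed.

Lemma classifies_by_coordinates (S : set K) (C : F -> F -> Prop) :
  (forall a, S a <-> exists u v, C u v /\ a = u%:A + v *: r) ->
  (forall u v, C u v -> v != 0) ->
  (forall u v u' v', C u v -> C u' v' -> coord_equiv u v u' v' ->
     u = u' /\ v = v') ->
  (forall u v, v != 0 -> exists u' v', C u' v' /\ coord_equiv u v u' v') ->
  classifies_quaternions s S.
Proof.
move=> SC C0 Cuniq Cex.
split.
- move=> a Sa; have [u [v [/C0 v0 aE]]] := (SC a).1 Sa.
  have aF : a \notin 1%VS by rewrite aE coord_in_base.
  split; first by exists K, s, a; split=> //; exact: alg_isomorphic_refl.
  exists (fun k => (k, 0)); split.
  + move=> c x y; by rewrite -[RHS]/(c *: x + y, c *: 0 + 0) scaler0 addr0.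
  + by move=> x y [].
  + move=> x y; rewrite -[RHS]/(quat_mul s a (x, 0) (y, 0)) /quat_mul /=.
    by rewrite !(rmorph0, mulr0, mul0r, addr0).
  + apply/seteqP; split=> [y [x _ <-]|[x y] /(left_nucleus_quaternion gal _ aF) /= ->].
      exact/(left_nucleus_quaternion gal _ aF).
    by exists x.
- move=> a b /SC[u [v [Cuv ->]]] /SC[u' [v' [Cuv' ->]]].
  move/(quaternion_iso_coord _ _ (C0 _ _ Cuv) (C0 _ _ Cuv')).
  by case/(Cuniq _ _ _ _ Cuv Cuv') => -> ->.
- move=> A qA nA; have [a aF Aa] := quaternion_of_nucleus qA nA.
  have [u [v aE]] := coordinates a; subst a; rewrite coord_in_base in aF.
  have [u' [v' [Cuv uv]]] := Cex u v aF; exists (u'%:A + v' *: r); split.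
    by apply/SC; exists u', v'.
  apply: alg_isomorphic_trans Aa _; apply/quaternion_iso_coord => //.
  exact: C0 Cuv.
Qed.

Section Representatives.
Variable T : set F.
Hypothesis repT : is_sign_representatives T.

Lemma sign_uniq x y : T x -> T y -> x = y \/ x = - y -> x = y.
Proof.
have [nT0 Tex] := repT; move=> Tx Ty xy.
have y0 : y != 0 by apply/eqP => y0; apply: nT0; rewrite -y0.
have [z [_ zu]] := Tex y y0.
by rewrite -(zu x (conj Tx xy)) -(zu y (conj Ty (or_introl erefl))).
Qed.

Lemma sign_ex v : v != 0 -> exists2 x, T x & v = x \/ v = - x.
Proof.
have [_ Tex] := repT; move=> /Tex[x [[Tx xv] _]]; exists x => //.
by case: xv => ->; [left | right; rewrite opprK].
Qed.

Lemma sign_neq0 x : T x -> x != 0.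
Proof.
by have [nT0 _] := repT; move=> Tx; apply/eqP => x0; apply: nT0; rewrite -x0.
Qed.

Variable e : F.
Hypothesis e0 : e != 0.
Hypothesis norm_index : forall c, c != 0 -> is_norm d c \/ is_norm d (c / e).
Hypothesis e_not_norm : ~ is_norm d e.

Lemma sign_uniq_scaled n x y : n = 1 -> T x -> T y ->
  x = n * y \/ x = - (n * y) -> x = y.
Proof. by move=> ->; rewrite mul1r; exact: sign_uniq. Qed.

(** Dividing by a norm takes u to 1 or to e; the sign of v is then used to land
    in T. *)
Lemma coord_equiv_normalize u v : u != 0 -> v != 0 ->
  exists u' x, [/\ u' = 1 \/ u' = e, T x & coord_equiv u v u' x].
Proof.
move=> u0 v0.
have key n u' : n != 0 -> is_norm d n -> u = n * u' ->
    exists2 x, T x & coord_equiv u v u' x.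
  move=> n0 nn uE; have [|x Tx vx] := @sign_ex (v / n).
    by rewrite mulf_neq0 ?invr_eq0.
  exists x => //; exists n; split=> //.
  by case: vx => vE; [left | right]; rewrite -?mulrN -vE mulrC divfK.
have [nu|nu] := norm_index u0.
  by have [x Tx ux] := key u 1 u0 nu (esym (mulr1 u)); exists 1, x; split=> //; left.
have [|x Tx ux] := key (u / e) e _ nu (esym (divfK e0 u)).
  by rewrite mulf_neq0 ?invr_eq0.
by exists e, x; split=> //; right.
Qed.

(** In both cases e would be a norm or the inverse of one. *)
Lemma norm_ratio_absurd n : n != 0 -> is_norm d n -> 1 = n * e \/ e = n * 1 -> False.
Proof.
move=> n0 nn []; last by rewrite mulr1 => en; apply: e_not_norm; rewrite en.
move=> ne; apply: e_not_norm; rewrite -[e]mul1r -(mulVf n0) -mulrA -ne mulr1.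
exact: is_normV.
Qed.

(** For u = 0 the sign of v is absorbed by the norm n, so r and e r represent
    different classes. *)
Lemma classifies_neg1_norm : is_norm d (-1) ->
  classifies_quaternions s ([set r; e *: r]
     `|` [set 1 + x *: r | x in T] `|` [set e%:A + x *: r | x in T])%classic.
Proof.
move=> neg1.
pose C u v := [\/ u = 0 /\ v = 1, u = 0 /\ v = e, u = 1 /\ T v | u = e /\ T v].
apply: (classifies_by_coordinates (C := C)).
- move=> a; split.
    case=> [[[->|->]|[x Tx <-]]|[x Tx <-]].
    + by exists 0, 1; split; [constructor 1 | rewrite scale0r scale1r add0r].
    + by exists 0, e; split; [constructor 2 | rewrite scale0r add0r].
    + by exists 1, x; split; [constructor 3 | rewrite scale1r].
    + by exists e, x; split; [constructor 4 |].
  case=> u [v [[[-> ->]|[-> ->]|[-> Tv]|[-> Tv]] ->]].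
  + by left; left; left; rewrite /= scale0r scale1r add0r.
  + by left; left; right; rewrite /= scale0r add0r.
  + by left; right; exists v; rewrite // scale1r.
  + by right; exists v.
- by move=> u v [[_ ->]|[_ ->]|[_ /sign_neq0]|[_ /sign_neq0]]; rewrite ?oner_neq0.
- have one_not (n x : F) : n != 0 -> x != 0 -> 0 = n * x -> False.
    by move=> n0 x0 /esym/eqP; rewrite mulf_eq0 (negPf n0) (negPf x0).
  have not_zero (n x : F) : x != 0 -> x = n * 0 -> False.
    by rewrite mulr0 => /eqP.
  have o0 := oner_neq0 F.
  (* as -1 is a norm, the sign can be moved into n *)
  have nneg n : is_norm d n -> is_norm d (- n).
    by move=> nn; rewrite -mulN1r; apply: is_normM.
  have opp_or n x y : n != 0 -> is_norm d n -> x = n * y \/ x = - (n * y) ->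
      exists m, [/\ m != 0, is_norm d m & x = m * y].
    move=> n0 nn [->|->]; first by exists n.
    by exists (- n); rewrite mulNr oppr_eq0; split=> //; apply: nneg.
  move=> u v u' v'.
  case=> [[-> ->]|[-> ->]|[-> Tv]|[-> Tv]]; case=> [[-> ->]|[-> ->]|[-> Tv']|[-> Tv']];
    case=> n [n0 nn uE vE] //;
    (* 0 and a nonzero first coordinate are never proportional *)
    try (by case: (one_not _ _ n0 _ uE)); try (by case: (not_zero _ _ _ uE)).
  + have [m [m0 nm h]] := opp_or _ _ _ n0 nn vE.
    by case: (@norm_ratio_absurd m) => //; left.
  + have [m [m0 nm h]] := opp_or _ _ _ n0 nn vE.
    by case: (@norm_ratio_absurd m) => //; right.
  + split=> //; apply: sign_uniq_scaled Tv Tv' vE.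
    by rewrite uE mulr1.
  + by case: (@norm_ratio_absurd n) => //; left.
  + by case: (@norm_ratio_absurd n) => //; right.
  + split=> //; apply: sign_uniq_scaled Tv Tv' vE.
    by apply: (mulIf e0); rewrite mul1r -uE.
- move=> u v v0; have [->|u0] := eqVneq u 0; last first.
    have [u' [x [u'E Tx uv]]] := coord_equiv_normalize u0 v0; exists u', x; split=> //.
    by case: u'E => ->; [constructor 3 | constructor 4].
  have [nv|nv] := norm_index v0.
    exists 0, 1; split; first by constructor 1.
    by exists v; split; rewrite ?mulr0 ?mulr1 //; left.
  exists 0, e; split; first by constructor 2.
  exists (v / e); split; rewrite ?mulr0 ?mulf_neq0 ?invr_eq0 //.
  by left; rewrite divfK.
Qed.

(** For u = 0 the sign of v exchanges the two norm classes, so r represents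
    both. *)
Lemma classifies_neg1_not_norm : e = -1 ->
  classifies_quaternions s ([set r]
     `|` [set 1 + x *: r | x in T] `|` [set -1 + x *: r | x in T])%classic.
Proof.
move=> eN1.
pose C u v := [\/ u = 0 /\ v = 1, u = 1 /\ T v | u = e /\ T v].
apply: (classifies_by_coordinates (C := C)).
- move=> a; split.
    case=> [[->|[x Tx <-]]|[x Tx <-]].
    + by exists 0, 1; split; [constructor 1 | rewrite scale0r scale1r add0r].
    + by exists 1, x; split; [constructor 2 | rewrite scale1r].
    + by exists e, x; split; [constructor 3 | rewrite eN1 scaleN1r].
  case=> u [v [[[-> ->]|[-> Tv]|[-> Tv]] ->]].
  + by left; left; rewrite /= scale0r scale1r add0r.
  + by left; right; exists v; rewrite // scale1r.
  + by right; exists v; rewrite // eN1 scaleN1r.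
- by move=> u v [[_ ->]|[_ /sign_neq0]|[_ /sign_neq0]]; rewrite ?oner_neq0.
- have one_not (n x : F) : n != 0 -> x != 0 -> 0 = n * x -> False.
    by move=> n0 x0 /esym/eqP; rewrite mulf_eq0 (negPf n0) (negPf x0).
  have not_zero (n x : F) : x != 0 -> x = n * 0 -> False.
    by rewrite mulr0 => /eqP.
  have o0 := oner_neq0 F.
  move=> u v u' v'.
  case=> [[-> ->]|[-> Tv]|[-> Tv]]; case=> [[-> ->]|[-> Tv']|[-> Tv']];
    case=> n [n0 nn uE vE] //;
    (* 0 and a nonzero first coordinate are never proportional *)
    try (by case: (one_not _ _ n0 _ uE)); try (by case: (not_zero _ _ _ uE)).
  + split=> //; apply: sign_uniq_scaled Tv Tv' vE.
    by rewrite uE mulr1.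
  + by case: (@norm_ratio_absurd n) => //; left.
  + by case: (@norm_ratio_absurd n) => //; right.
  + split=> //; apply: sign_uniq_scaled Tv Tv' vE.
    by apply: (mulIf e0); rewrite mul1r -uE.
- move=> u v v0; have [->|u0] := eqVneq u 0; last first.
    have [u' [x [u'E Tx uv]]] := coord_equiv_normalize u0 v0; exists u', x; split=> //.
    by case: u'E => ->; [constructor 2 | constructor 3].
  exists 0, 1; split; first by constructor 1.
  have [nv|nv] := norm_index v0.
    by exists v; split; rewrite ?mulr0 ?mulr1 //; left.
  exists (v / e); split; rewrite ?mulr0 ?mulf_neq0 ?invr_eq0 //.
  by right; rewrite eN1 invrN invr1 mulr1 mulrN mulr1 opprK.
Qed.
End Representatives.
End Coordinates.

Local Open Scope classical_set_scope.

Theorem theorem4p4 (F : local_field) (P : set F) (varpi eps : F) (l q : nat)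
    (T : set F) (K : fieldExtType F) (sigma : {lrmorphism K -> K}) :
  is_maximal_ideal (@integers F) P ->
  ideal_generator (@integers F) P varpi ->
  is_nonsquare_unit (@integers F) eps ->
  quotient_char P l -> odd l ->
  quotient_card (@integers F) P q ->
  is_sign_representatives T ->
  is_quadratic_galois sigma ->
  (forall r : K, is_adjoin_sqrt eps r ->
     classifies_quaternions sigma
       ([set r; varpi *: r]
        `|` [set 1 + s *: r | s in T]
        `|` [set varpi%:A + s *: r | s in T]))
  /\
  (forall (alpha : F) (r : K), alpha = varpi \/ alpha = eps * varpi ->
     is_adjoin_sqrt alpha r ->
     ((q = 1 %[mod 4])%N ->
        classifies_quaternions sigma
          ([set r; eps *: r]
           `|` [set 1 + s *: r | s in T]
           `|` [set eps%:A + s *: r | s in T]))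
     /\
     ((q = 3 %[mod 4])%N ->
        classifies_quaternions sigma
          ([set r]
           `|` [set 1 + s *: r | s in T]
           `|` [set -1 + s *: r | s in T]))).
Proof.
move=> maxP genP [ueps nsq] charl oddl cardq repT gal.
have hR := integers_henselian F.
have ne : nonsquare eps.
  move=> v vE; apply: nsq; exists v; split=> //.
  by apply: (is_unit_sqrt hR ueps).
have [varpi0 _ _] := ideal_generatorP hR maxP genP.
have uN1 := is_unitN hR (is_unit1 hR).
split=> [r rd|alpha r alphaE rd].
  apply: (classifies_neg1_norm gal rd repT varpi0).
  - exact: (unramified_norm_index hR maxP charl oddl cardq genP ueps ne).
  - exact: (unramified_uniformizer_not_norm hR maxP charl oddl genP ueps ne).
  - apply: (unramified_unit_norm hR maxP charl oddl cardq ueps ne).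
    exact: uN1.
have genA : ideal_generator (@integers F) P alpha.
  by case: alphaE => -> //; apply: (uniformizerM hR maxP genP).
split=> q4.
  apply: (classifies_neg1_norm gal rd repT (nonsquare_neq0 ne)).
  - exact: (ramified_norm_index hR maxP charl oddl cardq genA ueps ne).
  - exact: (ramified_nonsquare_not_norm hR maxP charl oddl genA ueps ne).
  - by have [w <-] := sqrt_neg1 hR maxP charl oddl cardq q4; apply: is_norm_sqr.
have nN1 := neg1_nonsquare hR maxP charl oddl cardq q4.
apply: (classifies_neg1_not_norm gal rd repT (nonsquare_neq0 nN1)) => //.
- exact: (ramified_norm_index hR maxP charl oddl cardq genA uN1 nN1).
- exact: (ramified_nonsquare_not_norm hR maxP charl oddl genA uN1 nN1).
Qed.
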